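(* Let $\widehat\rho=e^{\tau}\rho$ be another defining function, and let $\widehat B^{2\gamma}_{2j}$, $\widehat B^{2\gamma}_{2j+2[\gamma]}$ be the boundary operators associated with $(\mathcal U^{n+1},\widehat\rho^{\,2}g^{+})$. Let $V\in\mathcal C^{2\gamma}(\mathcal U^{n+1})$ and let $j$ be an integer with $0\le j\le\lfloor\gamma\rfloor$. Then $$\widehat B^{2\gamma}_{2j}(V)=e^{(-(n+1)+\gamma-2j)\,\tau|_{\mathbb H^n}}\,B^{2\gamma}_{2j}\big(e^{(n+1-\gamma)\tau}V\big),$$ $$\widehat B^{2\gamma}_{2j+2[\gamma]}(V)=e^{(-(n+1)+\gamma-2j-2[\gamma])\,\tau|_{\mathbb H^n}}\,B^{2\gamma}_{2j+2[\gamma]}\big(e^{(n+1-\gamma)\tau}V\big),$$ where $\tau|_{\mathbb H^n}$ is the restriction of $\tau$ to $\partial\mathcal U^{n+1}\cong\mathbb H^n$.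
   Context: Setting. Fix an integer $n\ge1$ and $\gamma\in(0,\infty)\setminus\mathbb N$; $\lfloor x\rfloor$ denotes the integer part, $[\gamma]=\gamma-\lfloor\gamma\rfloor$, $k=\lfloor\gamma\rfloor+1$, $s=\frac{n+1+\gamma}{2}$. Let $\mathcal U^{n+1}=\{(z,z_{n+1})\in\mathbb C^n\times\mathbb C: q>0\}$ with $q=\mathrm{Im}\,z_{n+1}-|z|^2$. Put $t=\mathrm{Re}\,z_{n+1}$, $\rho=(2q)^{1/2}$. The coordinates $(z,t,\rho)$ identify $\mathcal U^{n+1}$ with $\mathbb H^n\times(0,\infty)$ and $\partial\mathcal U^{n+1}=\{\rho=0\}$ with the Heisenberg group $\mathbb H^n=\mathbb C^n\times\mathbb R$. With $z_j=x_j+iy_j$ put $X_j=\partial_{x_j}+2y_j\partial_t$, $Y_j=\partial_{y_j}-2x_j\partial_t$, $T=2\partial_t$, $\Delta_b=\frac12\sum_{j=1}^n(X_j^2+Y_j^2)$. The metric $g^{+}$ is the complex hyperbolic metric with Kähler form $-\frac i2\partial\bar\partial\log q$; its Laplace–Beltrami operator is $\Delta_{\mathbb B}=\rho^2(\partial_{\rho\rho}+\Delta_b+\rho^2\partial_{tt})-(2n+1)\rho\partial_\rho$. Function spaces. $C^\infty_{\mathrm{even}}(\overline{\mathcal U^{n+1}})$ is the set of smooth functions up to the boundary whose Taylor expansion at $\rho=0$ contains only even powers of $\rho$, $\sum_{j\ge0}f_j(z,t)\rho^{2j}$ with $f_j$ smooth; $\mathcal C^{2\gamma}(\mathcal U^{n+1})=C^\infty_{\mathrm{even}}(\overline{\mathcal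 U^{n+1}})+\rho^{2[\gamma]}C^\infty_{\mathrm{even}}(\overline{\mathcal U^{n+1}})$. Whenever integrability is needed, functions are assumed to be sufficiently integrable. Operators. $\tilde\Delta_{\mathbb B}=\Delta_{\mathbb B}+(n+1)^2$; $D_{s-\ell}=\Delta_{\mathbb B}+4(s-\ell)(n+1-s+\ell)=\tilde\Delta_{\mathbb B}-(\gamma-2\ell)^2$; $L_{2k}^+=(-1)^k\prod_{j=0}^{k-1}D_{s-j}$; $L_{2k}V=\rho^{-(n+1+2k-\gamma)}L_{2k}^+(\rho^{n+1-\gamma}V)$; $\Pi^\gamma_j=(-1)^{\lfloor\gamma\rfloor}\prod_{0\le i\le\lfloor\gamma\rfloor,\,i\ne j}(\tilde\Delta_{\mathbb B}-(\gamma-2i)^2)$. Scattering. For $\mathrm{Re}\,s'>\frac{n+1}2$, $\mathcal P(s')f$ is the unique solution $u$ furnished by scattering theory of $\Delta_{\mathbb B}u+4s'(n+1-s')u=0$ with $u=q^{n+1-s'}F+q^{s'}G$, $F,G\in C^\infty_{\mathrm{even}}(\overline{\mathcal U^{n+1}})$, $F|_{\rho=0}=f$; $S(s')f=G|_{\rho=0}$. For non-integer $\delta>0$, $c_\delta=2^\delta\frac{\Gamma(\delta)}{\Gamma(-\delta)}$ and $P_\delta f=c_\delta S(\frac{n+1+\delta}2)f=(2|T|)^\delta\frac{\Gamma(\frac{1+\delta}2+\frac{-\Delta_b}{2|T|})}{\Gamma(\frac{1-\delta}2+\frac{-\Delta_b}{2|T|})}f$, the CR covariant operator of fractional order. Boundary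 operators for $(\mathcal U^{n+1},\rho^2g^+)$ (empty products are 1): - $B_0^{2\gamma}(f)=f|_{\rho=0}$. - For $1\le j\le\lfloor\gamma/2\rfloor$: $B_{2j}^{2\gamma}(f)=\frac1{b_{2j}}\rho^{-(n+1)+\gamma-2j}\prod_{\ell=0}^{j-1}D_{s-\ell}\prod_{\ell=\lfloor\gamma\rfloor-j+1}^{\lfloor\gamma\rfloor}D_{s-\ell}(\rho^{n+1-\gamma}f)|_{\rho=0}$, $b_{2j}=4^{2j}j!\frac{\Gamma(\gamma+1-j)\Gamma(\lfloor\gamma\rfloor+1-j)\Gamma(j+1-[\gamma])}{\Gamma(\gamma+1-2j)\Gamma(\lfloor\gamma\rfloor+1-2j)\Gamma(1-[\gamma])}$. - For $0\le j\le\lfloor\gamma\rfloor-\lfloor\gamma/2\rfloor-1$: $B_{2j+2[\gamma]}^{2\gamma}(f)=\frac1{b_{2j+2[\gamma]}}\rho^{-(n+1)+\gamma-2j-2[\gamma]}\prod_{\ell=0}^{j}D_{s-\ell}\prod_{\ell=\lfloor\gamma\rfloor-j+1}^{\lfloor\gamma\rfloor}D_{s-\ell}(\rho^{n+1-\gamma}f)|_{\rho=0}$, $b_{2j+2[\gamma]}=-4^{2j+1}j!\frac{\Gamma(j+1+[\gamma])\Gamma(\lfloor\gamma\rfloor+1-j)\Gamma(\lfloor\gamma\rfloor+1-j-[\gamma])}{\Gamma([\gamma])\Gamma(\lfloor\gamma\rfloor-2j)\Gamma(\lfloor\gamma\rfloor+1-2j-[\gamma])}$. - For the remaining indices let $\tilde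 V$ denote the solution of $L_{2k}\tilde V=0$ with $B_{2j}^{2\gamma}(\tilde V)=B_{2j}^{2\gamma}(V)$ ($0\le j\le\lfloor\gamma/2\rfloor$) and $B_{2j+2[\gamma]}^{2\gamma}(\tilde V)=B_{2j+2[\gamma]}^{2\gamma}(V)$ ($0\le j\le\lfloor\gamma\rfloor-\lfloor\gamma/2\rfloor-1$), namely $\tilde V=\sum_{j=0}^{\lfloor\gamma/2\rfloor}2^{\frac{n+1-\gamma+2j}2}\rho^{-(n+1)+\gamma}\mathcal P(\tfrac{n+1+\gamma-2j}2)B_{2j}^{2\gamma}(V)+\sum_{j=0}^{\lfloor\gamma\rfloor-\lfloor\gamma/2\rfloor-1}2^{\frac{n+1-\lfloor\gamma\rfloor+[\gamma]+2j}2}\rho^{-(n+1)+\gamma}\mathcal P(\tfrac{n+1+\lfloor\gamma\rfloor-[\gamma]-2j}2)B_{2j+2[\gamma]}^{2\gamma}(V)$. - For $\lfloor\gamma/2\rfloor+1\le j\le\lfloor\gamma\rfloor$: $B_{2j}^{2\gamma}(V)=\frac1{b_{2j}}\rho^{-2j-n-1+\gamma}\Pi_j^\gamma(\rho^{n+1-\gamma}(V-\tilde V))|_{\rho=0}+\frac{2^{\gamma-2j}}{c_{2j-\gamma}}P_{2j-\gamma}B^{2\gamma}_{2\gamma-2j}(V)$, with $b_{2j}=(-1)^{\lfloor\gamma\rfloor}\prod_{0\le i\le\lfloor\gamma\rfloor,\,i\ne j}((\gamma-2j)^2-(\gamma-2i)^2)$. - For $\lfloor\gamma\rfloor-\lfloor\gamma/2\rfloor\le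 j\le\lfloor\gamma\rfloor$: $B_{2j+2[\gamma]}^{2\gamma}(V)=\frac1{b_{2j+2[\gamma]}}\rho^{-2j-2[\gamma]-n-1+\gamma}\Pi^\gamma_{\lfloor\gamma\rfloor-j}(\rho^{n+1-\gamma}(V-\tilde V))|_{\rho=0}+\frac{2^{\lfloor\gamma\rfloor-2j-[\gamma]}}{c_{2j+[\gamma]-\lfloor\gamma\rfloor}}P_{2j+[\gamma]-\lfloor\gamma\rfloor}B^{2\gamma}_{2\lfloor\gamma\rfloor-2j}(V)$, with $b_{2j+2[\gamma]}=(-1)^{\lfloor\gamma\rfloor}\prod_{0\le i\le\lfloor\gamma\rfloor,\,i\ne\lfloor\gamma\rfloor-j}((\gamma-2j-2[\gamma])^2-(\gamma-2i)^2)$. Boundary operators for $(\mathcal U^{n+1},\widehat\rho^{\,2}g^+)$: $\widehat B$ is defined by exactly the same formulas and constants (with the same operators $D_{s-\ell}$, $\Pi_j^\gamma$, built from $\Delta_{\mathbb B}$), with $\rho$ replaced by $\widehat\rho$, $B$ by $\widehat B$, $\tilde V$ by $\widehat{\tilde V}$, and $P_\delta$ by $\widehat P_\delta$ (and $\widehat B_0^{2\gamma}(V)=V|_{\rho=0}$). Here $\widehat{\tilde V}$ is the solution $W$ of $\widehat\rho^{\,-(n+1)+\gamma-2k}L_{2k}^+(\widehat\rho^{\,n+1-\gamma}W)=0$ in $\mathcal U^{n+1}$ with $\widehat B^{2\gamma}_{2j}(W)=\widehat B^{2\gamma}_{2j}(V)$ ($0\le j\le\lfloor\gamma/2\rfloor$)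 and $\widehat B^{2\gamma}_{2j+2[\gamma]}(W)=\widehat B^{2\gamma}_{2j+2[\gamma]}(V)$ ($0\le j\le\lfloor\gamma\rfloor-\lfloor\gamma/2\rfloor-1$). The operator $\widehat P_\delta$ is the CR covariant operator of fractional order $\delta$ corresponding to the defining function $\widehat\rho$ in place of $\rho$; since $P_\delta$ is a CR covariant operator, the two are related by $P_\delta\big(e^{(n+1-\delta)\tau|_{\mathbb H^n}}h\big)=e^{(n+1+\delta)\tau|_{\mathbb H^n}}\widehat P_\delta h$. *)

(* Defs.v *)
From HB Require Import structures.
From mathcomp Require Import all_boot all_order all_algebra.
From mathcomp Require Import all_classical all_reals all_analysis.

Set Implicit Arguments.
Unset Strict Implicit.
Unset Printing Implicit Defensive.

Import Order.TTheory GRing.Theory Num.Theory numFieldNormedType.Exports.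
Local Open Scope classical_set_scope.
Local Open Scope ring_scope.

(* The Heisenberg group: ((x, y), t) stands for (z, t) with z = x + i y.     *)
Definition heis (R : realType) (n : nat) : normedModType R :=
  ('rV[R]_n * 'rV[R]_n * R)%type.
Arguments heis : clear implicits.

(* Points ((z, t), rho).  U^{n+1} is the part rho > 0 and its boundary is    *)
(* rho = 0; a function on U^{n+1} is a total function on this type, of which *)
(* only the values at rho > 0 matter.                                        *)
Definition upoint (R : realType) (n : nat) : normedModType R :=
  (heis R n * R)%type.
Arguments upoint : clear implicits.

(* The unique x satisfying P, and d if there is none or more than one.       *)
Definition the (T : choiceType) (d : T) (P : set T) : T :=
  xget d [set x | unique P x].

(* Euler's limit n! n^x / (x (x + 1) ... (x + n)), which gives Gamma at      *)
(* every real x that is not a nonpositive integer.                           *)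
Definition Gamma (R : realType) (x : R) : R :=
  limn (fun m : nat => (m`!)%:R * m%:R `^ x / \prod_(i < m.+1) (x + i%:R)).

Section Geometry.
Context {R : realType} {n : nat}.
Implicit Types (u v f : upoint R n -> R) (p : upoint R n) (h : heis R n).

Definition rho p : R := p.2.
Definition yco (j : 'I_n) p : R := p.1.1.2 0 j.
Definition xco (j : 'I_n) p : R := p.1.1.1 0 j.

Definition dir_x (j : 'I_n) : upoint R n := (delta_mx 0 j, 0, 0, 0).
Definition dir_y (j : 'I_n) : upoint R n := (0, delta_mx 0 j, 0, 0).
Definition dir_t : upoint R n := (0, 0, 1, 0).
Definition dir_rho : upoint R n := (0, 0, 0, 1).

(* The derivative of u in the direction v. *)
Definition partial (v : upoint R n) u : upoint R n -> R :=
  fun p => 'D_v u p.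

Definition X (j : 'I_n) u : upoint R n -> R :=
  fun p => partial (dir_x j) u p + 2 * yco j p * partial dir_t u p.
Definition Y (j : 'I_n) u : upoint R n -> R :=
  fun p => partial (dir_y j) u p - 2 * xco j p * partial dir_t u p.

Definition Delta_b u : upoint R n -> R :=
  fun p => 2^-1 * \sum_(j < n) (X j (X j u) p + Y j (Y j u) p).

Definition Delta_B u : upoint R n -> R := fun p =>
  rho p ^+ 2 * (partial dir_rho (partial dir_rho u) p + Delta_b u p
                + rho p ^+ 2 * partial dir_t (partial dir_t u) p)
  - (2 * n + 1)%:R * rho p * partial dir_rho u p.

Definition iter_partial (vs : seq (upoint R n)) u : upoint R n -> R :=
  foldr partial u vs.

Definition smooth u : Prop := forall vs : seq (upoint R n),
  continuous (iter_partial vs u)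
  /\ forall (v : upoint R n) p, derivable (iter_partial vs u) p v.

(* Smooth up to the boundary means: restriction of a function that is smooth *)
(* across rho = 0.  The last clause says that the Taylor expansion at        *)
(* rho = 0 has only even powers of rho.                                      *)
Definition C_even u : Prop := exists g : upoint R n -> R,
  [/\ smooth g,
      forall p, 0 < rho p -> u p = g p
    & forall (m : nat) h, odd m -> iter_partial (nseq m dir_rho) g (h, 0) = 0].

(* The restriction of u to rho = 0. *)
Definition trace u : heis R n -> R :=
  fun h => lim (u (h, r) @[r --> 0^'+]).

(* Scattering with respect to a defining function r, with q = r^2 / 2 in     *)
(* the expansion of u; the equation is that of Delta_B for every r.          *)
(* Since u = rho^(2 s) solves the equation with f = 0, uniqueness needs      *)
(* integrability: we ask rho^(- 2 (n + 1 - s)) u, which restricts to a       *)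
(* multiple of f on rho = 0 and solves an equation without zeroth order      *)
(* term, to vanish at infinity.  The first clause is the normalization of u  *)
(* outside U^{n+1} which makes u unique as a total function.                 *)
Record scattering (r : upoint R n -> R) (s : R) (f : heis R n -> R)
    (u F G : upoint R n -> R) : Prop := Scattering {
  scattering_out : forall p, rho p <= 0 -> u p = 0;
  scattering_eq : forall p, 0 < rho p ->
    Delta_B u p + 4 * s * (n.+1%:R - s) * u p = 0;
  scattering_exp : forall p, 0 < rho p ->
    u p = (r p ^+ 2 / 2) `^ (n.+1%:R - s) * F p + (r p ^+ 2 / 2) `^ s * G p;
  scattering_F : C_even F;
  scattering_G : C_even G;
  scattering_data : trace F = f;
  scattering_decay : forall e : R, 0 < e -> exists M : R,
    forall p, 0 < rho p -> M < `|p| ->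
      `|rho p `^ (- (2 * (n.+1%:R - s))) * u p| < e
}.

Definition is_poisson (r : upoint R n -> R) (s : R) (f : heis R n -> R) :
    set (upoint R n -> R) :=
  [set u | exists F G, scattering r s f u F G].

Definition poisson (s : R) (f : heis R n -> R) : upoint R n -> R :=
  the (cst 0) (is_poisson rho s f).

Definition scatter (r : upoint R n -> R) (s : R) (f : heis R n -> R) :
    heis R n -> R :=
  the (cst 0) [set g | exists u F G, scattering r s f u F G /\ trace G = g].

Definition cconst (delta : R) : R :=
  2 `^ delta * (Gamma delta / Gamma (- delta)).

(* P_delta for r = rho, and its analogue for another defining function r. *)
Definition Pfrac (r : upoint R n -> R) (delta : R) (f : heis R n -> R) :
    heis R n -> R :=
  fun h => cconst delta * scatter r ((n.+1%:R + delta) / 2) f h.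

End Geometry.

Section BoundaryOperators.
Context {R : realType} {n : nat}.
Variable gamma : R.
Implicit Types (r u V W : upoint R n -> R) (h : heis R n) (j l : nat).

Definition fl : nat := Num.truncn gamma.
Definition flh : nat := Num.truncn (gamma / 2).
Definition frac : R := gamma - fl%:R.
Definition kk : nat := fl.+1.
Definition ss : R := (n.+1%:R + gamma) / 2.

Definition C2gamma V : Prop := exists f g : upoint R n -> R,
  [/\ C_even f, C_even g
    & forall p, 0 < rho p -> V p = f p + rho p `^ (2 * frac) * g p].

(* D_{s-l}, which is also tilde Delta_B - (gamma - 2 l)^2. *)
Definition Dop l u : upoint R n -> R := fun p =>
  Delta_B u p + 4 * (ss - l%:R) * (n.+1%:R - ss + l%:R) * u p.

Definition Dprod (ls : seq nat) u : upoint R n -> R := foldr Dop u ls.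

Definition Lplus u : upoint R n -> R :=
  fun p => (-1) ^+ kk * Dprod (iota 0 kk) u p.

Definition Pi j u : upoint R n -> R :=
  fun p => (-1) ^+ fl * Dprod [seq i <- iota 0 fl.+1 | i != j] u p.

Definition scaled r V : upoint R n -> R :=
  fun p => r p `^ (n.+1%:R - gamma) * V p.

Definition L2k r V : upoint R n -> R := fun p =>
  r p `^ (- (n.+1%:R + 2 * kk%:R - gamma)) * Lplus (scaled r V) p.

(* Constants b_{2j} and b_{2j+2[gamma]}: "lo" in the range where the         *)
(* boundary operator is given by D's, "hi" in the range where it uses Pi.    *)
Definition b_ev_lo j : R := 4 ^+ (2 * j) * (j`!)%:R *
  (Gamma (gamma + 1 - j%:R) * Gamma (fl%:R + 1 - j%:R)
     * Gamma (j%:R + 1 - frac)) /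
  (Gamma (gamma + 1 - 2 * j%:R) * Gamma (fl%:R + 1 - 2 * j%:R)
     * Gamma (1 - frac)).

Definition b_od_lo j : R := - (4 ^+ (2 * j + 1) * (j`!)%:R *
  (Gamma (j%:R + 1 + frac) * Gamma (fl%:R + 1 - j%:R)
     * Gamma (fl%:R + 1 - j%:R - frac)) /
  (Gamma frac * Gamma (fl%:R - 2 * j%:R)
     * Gamma (fl%:R + 1 - 2 * j%:R - frac))).

Definition b_ev_hi j : R := (-1) ^+ fl * \prod_(0 <= i < fl.+1 | i != j)
  ((gamma - 2 * j%:R) ^+ 2 - (gamma - 2 * i%:R) ^+ 2).

Definition b_od_hi j : R :=
  (-1) ^+ fl * \prod_(0 <= i < fl.+1 | i != (fl - j)%N)
  ((gamma - 2 * j%:R - 2 * frac) ^+ 2 - (gamma - 2 * i%:R) ^+ 2).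

(* B_{2j} for 0 <= j <= flh. *)
Definition B_ev_lo r j V : heis R n -> R :=
  if j == 0%N then trace V else fun h =>
  (b_ev_lo j)^-1 * trace (fun p =>
    r p `^ (- n.+1%:R + gamma - 2 * j%:R)
    * Dprod (iota 0 j ++ iota (fl - j + 1) j) (scaled r V) p) h.

(* B_{2j+2[gamma]} for 0 <= j <= fl - flh - 1. *)
Definition B_od_lo r j V : heis R n -> R := fun h =>
  (b_od_lo j)^-1 * trace (fun p =>
    r p `^ (- n.+1%:R + gamma - 2 * j%:R - 2 * frac)
    * Dprod (iota 0 j.+1 ++ iota (fl - j + 1) j) (scaled r V) p) h.

(* B_{2j} for flh + 1 <= j <= fl, where W is the extension of the lower      *)
(* boundary data of V.  Here 2 gamma - 2 j = 2 (fl - j) + 2 [gamma].         *)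
Definition B_ev_hi r j V W : heis R n -> R := fun h =>
  (b_ev_hi j)^-1 * trace (fun p =>
    r p `^ (- (2 * j%:R) - n.+1%:R + gamma)
    * Pi j (scaled r (fun p' => V p' - W p')) p) h
  + 2 `^ (gamma - 2 * j%:R) / cconst (2 * j%:R - gamma)
    * Pfrac r (2 * j%:R - gamma) (B_od_lo r (fl - j) V) h.

(* B_{2j+2[gamma]} for fl - flh <= j <= fl. *)
Definition B_od_hi r j V W : heis R n -> R := fun h =>
  (b_od_hi j)^-1 * trace (fun p =>
    r p `^ (- (2 * j%:R) - 2 * frac - n.+1%:R + gamma)
    * Pi (fl - j)%N (scaled r (fun p' => V p' - W p')) p) h
  + 2 `^ (fl%:R - 2 * j%:R - frac) / cconst (2 * j%:R + frac - fl%:R)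
    * Pfrac r (2 * j%:R + frac - fl%:R) (B_ev_lo r (fl - j) V) h.

Definition B_ev_gen r j V W : heis R n -> R :=
  if (j <= flh)%N then B_ev_lo r j V else B_ev_hi r j V W.

Definition B_od_gen r j V W : heis R n -> R :=
  if (j < fl - flh)%N then B_od_lo r j V else B_od_hi r j V W.

(* Scattering parameters of the extensions of B_{2j} V, j <= flh, and of     *)
(* B_{2j+2[gamma]} V, j < fl - flh.                                          *)
Definition s_ev j : R := (n.+1%:R + gamma - 2 * j%:R) / 2.
Definition s_od j : R := (n.+1%:R + fl%:R - frac - 2 * j%:R) / 2.

Definition tildeV V : upoint R n -> R := fun p =>
  \sum_(0 <= j < flh.+1)
    2 `^ ((n.+1%:R - gamma + 2 * j%:R) / 2) * rho p `^ (- n.+1%:R + gamma)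
    * poisson (s_ev j) (B_ev_lo rho j V) p
  + \sum_(0 <= j < fl - flh)
    2 `^ ((n.+1%:R - fl%:R + frac + 2 * j%:R) / 2)
    * rho p `^ (- n.+1%:R + gamma)
    * poisson (s_od j) (B_od_lo rho j V) p.

(* Standing integrability assumption: scattering theory furnishes the        *)
(* functions P(s')f occurring in tildeV.                                     *)
Definition sufficiently_integrable V : Prop :=
  (forall j, (j <= flh)%N ->
     exists! u, is_poisson rho (s_ev j) (B_ev_lo rho j V) u)
  /\ (forall j, (j < fl - flh)%N ->
     exists! u, is_poisson rho (s_od j) (B_od_lo rho j V) u).

(* W solves the boundary value problem defining the extension with respect   *)
(* to r.  The equation is a product of the equations of scattering theory,   *)
(* and W is sought (as it must be for uniqueness) among the sums of          *)
(* solutions furnished by scattering theory, with arbitrary boundary data.   *)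
Record is_extension r V W : Prop := IsExtension {
  extension_out : forall p, rho p <= 0 -> W p = 0;
  extension_eq : forall p, 0 < rho p -> L2k r W p = 0;
  extension_ev : forall j, (j <= flh)%N -> B_ev_lo r j W = B_ev_lo r j V;
  extension_od : forall j, (j < fl - flh)%N -> B_od_lo r j W = B_od_lo r j V;
  extension_class : exists (f g : nat -> heis R n -> R)
      (u v : nat -> upoint R n -> R),
    [/\ forall j, (j <= flh)%N -> is_poisson rho (s_ev j) (f j) (u j),
        forall j, (j < fl - flh)%N -> is_poisson rho (s_od j) (g j) (v j)
      & forall p, 0 < rho p -> scaled r W p =
          \sum_(0 <= j < flh.+1) u j p + \sum_(0 <= j < fl - flh) v j p]
}.

Definition extension r V : upoint R n -> R :=
  the (cst 0) [set W | is_extension r V W].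

Definition B_ev j V : heis R n -> R := B_ev_gen rho j V (tildeV V).
Definition B_od j V : heis R n -> R := B_od_gen rho j V (tildeV V).

Definition rhohat (tau : upoint R n -> R) : upoint R n -> R :=
  fun p => expR (tau p) * rho p.

Definition Bhat_ev tau j V : heis R n -> R :=
  B_ev_gen (rhohat tau) j V (extension (rhohat tau) V).
Definition Bhat_od tau j V : heis R n -> R :=
  B_od_gen (rhohat tau) j V (extension (rhohat tau) V).

End BoundaryOperators.

(* Main.v *)
(** Put U = e^((n+1-gamma) tau) V and r = e^tau rho.  On rho > 0 one has
r^(n+1-gamma) V = rho^(n+1-gamma) U, so every operator built from the D_{s-l}
sees the same function for (r, V) as for (rho, U), and only the outer power of
r produces a power of e^tau.  This settles the lower boundary operators.  For
the upper ones, two points remain.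

The extension with respect to r is e^(-(n+1-gamma) tau) tildeV(U).  Each D_{s-l}
acts on a scattering solution by a scalar, so applying the product of D's in a
lower boundary operator to a sum of scattering solutions kills the terms of
smaller index, while the terms of larger index are o(1) after division by the
power of rho; what survives is the boundary datum of the matching index, times
a product of eigenvalues which the functional equation of Gamma identifies with
b_{2j} or b_{2j+2[gamma]}.  Hence the lower boundary operators determine the
terms of such a sum, which gives both existence and uniqueness.

The covariance of P_delta holds because rescaling the defining function
multiplies the coefficients F and G of a scattering solution by the functions
e^(2(n+1-s) tau) and e^(2 s tau), and the even functions form a ring stable
under exp. *)

Require Import Defs.
From HB Require Import structures.
From mathcomp Require Import all_boot all_order all_algebra.
From mathcomp Require Import all_classical all_reals all_analysis.
From mathcomp Require Import ring lra zify.
Import Order.TTheory GRing.Theory Num.Theory numFieldNormedType.Exports.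
Local Open Scope classical_set_scope.
Local Open Scope ring_scope.

Set Implicit Arguments.
Unset Strict Implicit.

(** * Smooth functions and parity in rho *)

Section Smooth.
Context {R : realType} {n : nat}.
Implicit Types (f g u : upoint R n -> R) (p v : upoint R n) (h : heis R n).

(** Restricting to the line [t *: v + p] turns the directional derivative into a derivative in [t],
    where the one-variable chain rule applies. *)
Lemma is_derive_comp (phi : R -> R) f p v (a b : R) :
  is_derive (f p) 1 phi a -> is_derive p v f b ->
  is_derive p v (fun q => phi (f q)) (a * b).
Proof.
move=> phiD fD.
have lineE (k : upoint R n -> R) :
    'D_v k p = 'D_1 (fun t : R => k (t *: v + p)) 0.
  rewrite /derive; set k1 := fun t => t^-1 *: _; set k2 := fun t => t^-1 *: _.
  suff -> : k1 = k2 by [].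
  by apply/funext => t; rewrite /k1 /k2 /= addr0 scale0r add0r [_%:A]mulr1.
have fD' : is_derive (0 : R) 1 (fun t : R => f (t *: v + p)) b.
  case: fD => fd <-; split; last by rewrite lineE.
  exact: (iffLR (derivable1P f p v) fd).
have phiD' : is_derive (f ((0 : R) *: v + p)) 1 phi a by rewrite scale0r add0r.
have [dc ec] := is_derive1_comp phiD' fD'.
split; last by rewrite lineE.
exact: (iffRL (derivable1P (fun q => phi (f q)) p v) dc).
Qed.

Lemma is_derive_linear f p v :
  (forall t : R, f (t *: v + p) = t * f v + f p) -> is_derive p v f (f v).
Proof.
move=> fE.
have cv : t^-1 *: ((f \o shift p) (t *: v) - f p) @[t --> (0 : R)^'] --> f v.
  have : (fun _ : R => f v) t @[t --> (0 : R)^'] --> f v by exact: cvg_cst.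
  apply: cvg_trans; apply: near_eq_cvg; near=> t.
  rewrite /cst /= fE addrK /GRing.scale /= mulrA mulVf ?mul1r//.
  by near: t; exact: nbhs_dnbhs_neq.
split; first exact: cvgP cv.
exact: cvg_lim.
Unshelve. all: by end_near. Qed.

Lemma partialE f v p (a : R) : is_derive p v f a -> partial v f p = a.
Proof. by case. Qed.

Lemma smooth_continuous f : smooth f -> continuous f.
Proof. by move=> /(_ [::]) []. Qed.

Lemma smooth_derivable f p v : smooth f -> derivable f p v.
Proof. by move=> /(_ [::]) []. Qed.

Lemma smooth_partial f v : smooth f -> smooth (partial v f).
Proof.
move=> fs vs.
by move: (fs (rcons vs v)); rewrite /iter_partial foldr_rcons.
Qed.

(** Coinduction principle: [smooth] is the largest class of continuous, differentiable functions
    stable under [partial]. *)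
Lemma smooth_coind (A : (upoint R n -> R) -> Prop) :
  (forall f, A f -> continuous f /\ forall v p, derivable f p v) ->
  (forall f v, A f -> A (partial v f)) ->
  forall f, A f -> smooth f.
Proof.
move=> Ad Ap f Af vs; apply: Ad.
by elim: vs => //= v vs; exact: Ap.
Qed.

Lemma smooth_cst (c : R) : smooth (fun _ : upoint R n => c).
Proof.
apply: (@smooth_coind (fun f => exists a : R, f = fun=> a)); last by exists c.
- move=> _ [a ->]; split; first exact: cst_continuous.
  by move=> v p; exact: derivable_cst.
- by move=> _ v [a ->]; exists 0; apply/funext => p; exact: derive_cst.
Qed.

Lemma smooth_linear f :
  (forall p v (t : R), f (t *: v + p) = t * f v + f p) -> continuous f ->
  smooth f.
Proof.
move=> fE fc; apply: (@smooth_coind (fun g => g = f \/ smooth g)); last by left.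
- move=> g [->|gs]; split => //; last by move=> v p; exact: smooth_derivable.
    by move=> v p; case: (is_derive_linear (fE p v)).
  exact: smooth_continuous.
- move=> g v [->|gs]; right; last exact: smooth_partial.
  suff -> : partial v f = fun=> f v by exact: smooth_cst.
  by apply/funext => p; apply: partialE; exact: is_derive_linear.
Qed.

(** A formal closure whose members have all their derivatives in it again, so that [smooth_coind]
    applies without any formula for iterated derivatives of products and exponentials. *)
Inductive smooth_closure : (upoint R n -> R) -> Prop :=
| sc_smooth f : smooth f -> smooth_closure f
| sc_add f g : smooth_closure f -> smooth_closure g ->
    smooth_closure (fun p => f p + g p)
| sc_mul f g : smooth_closure f -> smooth_closure g ->
    smooth_closure (fun p => f p * g p)
| sc_exp f : smooth_closure f -> smooth_closure (fun p => expR (f p)).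

Lemma sc_continuous f : smooth_closure f -> continuous f.
Proof.
elim=> {f}[f /smooth_continuous //|f g _ fc _ gc|f g _ fc _ gc|f _ fc] p.
- exact: (cvgD (fc p) (gc p)).
- exact: (cvgM (fc p) (gc p)).
- by apply: continuous_comp; [exact: fc | exact: continuous_expR].
Qed.

Lemma is_derive_add f g p v : derivable f p v -> derivable g p v ->
  is_derive p v (fun q => f q + g q) (partial v f p + partial v g p).
Proof.
by move=> /derivableP fd /derivableP gd; exact: (is_deriveD fd gd).
Qed.

Lemma is_derive_mul f g p v : derivable f p v -> derivable g p v ->
  is_derive p v (fun q => f q * g q) (f p * partial v g p + g p * partial v f p).
Proof.
by move=> /derivableP fd /derivableP gd; exact: (is_deriveM fd gd).
Qed.

Lemma is_derive_exp f p v : derivable f p v ->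
  is_derive p v (fun q => expR (f q)) (expR (f p) * partial v f p).
Proof.
by move=> /derivableP fd; apply: is_derive_comp fd; exact: is_derive_expR.
Qed.

Lemma sc_derivable f p v : smooth_closure f -> derivable f p v.
Proof.
elim=> {f}[f fs|f g _ fd _ gd|f g _ fd _ gd|f _ fd].
- exact: smooth_derivable.
- by case: (is_derive_add fd gd).
- by case: (is_derive_mul fd gd).
- by case: (is_derive_exp fd).
Qed.

Lemma partial_add v f g : (forall p, derivable f p v) ->
  (forall p, derivable g p v) ->
  partial v (fun q => f q + g q) = fun p => partial v f p + partial v g p.
Proof. by move=> fd gd; apply/funext => p; exact/partialE/is_derive_add. Qed.

Lemma partial_mul v f g : (forall p, derivable f p v) ->
  (forall p, derivable g p v) ->
  partial v (fun q => f q * g q) =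
  fun p => f p * partial v g p + g p * partial v f p.
Proof. by move=> fd gd; apply/funext => p; exact/partialE/is_derive_mul. Qed.

Lemma partial_exp v f : (forall p, derivable f p v) ->
  partial v (fun q => expR (f q)) = fun p => expR (f p) * partial v f p.
Proof. by move=> fd; apply/funext => p; exact/partialE/is_derive_exp. Qed.

Lemma sc_partial f v : smooth_closure f -> smooth_closure (partial v f).
Proof.
elim=> {f}[f fs|f g fs fd gs gd|f g fs fd gs gd|f fs fd].
- exact/sc_smooth/smooth_partial.
- rewrite partial_add; [exact: sc_add|..] => p; exact: sc_derivable.
- rewrite partial_mul; [|by move=> p; exact: sc_derivable..].
  by apply: sc_add; exact: sc_mul.
- rewrite partial_exp; last by move=> p; exact: sc_derivable.
  by apply: sc_mul => //; exact: sc_exp.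
Qed.

Lemma smooth_closureP f : smooth_closure f -> smooth f.
Proof.
move=> fA; apply: (@smooth_coind smooth_closure) fA.
- move=> g gA; split; first exact: sc_continuous.
  by move=> v p; exact: sc_derivable.
- by move=> g v; exact: sc_partial.
Qed.

(** Here [b] is the parity in rho, [true] meaning odd: the rho-derivatives of the other parity
    vanish on the boundary. *)
Definition rho_parity (b : bool) f := smooth f /\
  forall (m : nat) h, odd m != b -> iter_partial (nseq m dir_rho) f (h, 0) = 0.

(** The graded analogue of [smooth_closure]. Odd functions are included because the rho-derivative
    of an even function is odd. *)
Inductive parity_closure : bool -> (upoint R n -> R) -> Prop :=
| pc_base b f : rho_parity b f -> parity_closure b f
| pc_add b f g : parity_closure b f -> parity_closure b g ->
    parity_closure b (fun p => f p + g p)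
| pc_mul b c f g : parity_closure b f -> parity_closure c g ->
    parity_closure (b (+) c) (fun p => f p * g p)
| pc_exp f : parity_closure false f ->
    parity_closure false (fun p => expR (f p)).

Lemma pc_sc b f : parity_closure b f -> smooth_closure f.
Proof.
elim=> {b f}[b f [fs _]|b f g _ fA _ gA|b c f g _ fA _ gA|f _ fA].
- exact: sc_smooth.
- exact: sc_add.
- exact: sc_mul.
- exact: sc_exp.
Qed.

Lemma pc_partial b f :
  parity_closure b f -> parity_closure (~~ b) (partial dir_rho f).
Proof.
have dA c k : parity_closure c k -> forall p, derivable k p dir_rho.
  by move=> /pc_sc kA p; exact: sc_derivable.
elim=> {b f}[b f [fs fb]|b f g fA fd gA gd|b c f g fA fd gA gd|f fA fd].
- apply: pc_base; split; first exact: smooth_partial.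
  move=> m h mb; have := fb m.+1 h.
  rewrite -[m.+1]addn1 nseqD /iter_partial foldr_cat /=; apply.
  by move: mb; rewrite addn1 /=; case: (odd m); case: (b).
- rewrite partial_add; [exact: pc_add | exact: dA fA | exact: dA gA].
- rewrite partial_mul; [|exact: dA fA|exact: dA gA].
  apply: pc_add; first by rewrite -addbN; exact: pc_mul.
  by rewrite -addNb addbC; exact: pc_mul.
- rewrite partial_exp; last exact: dA fA.
  by rewrite -[~~ false]addFb; apply: pc_mul => //; exact: pc_exp.
Qed.

Lemma pc_odd0 b f h : parity_closure b f -> b -> f (h, 0) = 0.
Proof.
elim=> {b f}[b f [fs fb]|b f g _ fA _ gA|b c f g _ fA _ gA|//].
- by move=> bT; apply: (fb 0%N); rewrite bT.
- by move=> bT; rewrite fA// gA// addr0.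
- case: b fA; case: c gA => //= gA fA _; first by rewrite fA// mul0r.
  by rewrite gA// mulr0.
Qed.

(** Each rho-derivative flips the parity, so the one of order [m] has parity [b (+) odd m]; where
    this is odd, the derivative vanishes on the boundary by [pc_odd0]. *)
Lemma parity_closureP b f : parity_closure b f -> rho_parity b f.
Proof.
move=> fA; split; first exact/smooth_closureP/pc_sc/fA.
move=> m h mb; apply: (@pc_odd0 (b (+) odd m)); last first.
  by move: mb; case: (odd m); case: (b).
elim: m {mb} => [|m IH]; first by rewrite addbF.
by rewrite /= addbN; exact: pc_partial.
Qed.

Lemma C_evenP f : C_even f <->
  exists2 g, parity_closure false g & forall p, 0 < rho p -> f p = g p.
Proof.
split=> [[g [gs fg go]]|[g /parity_closureP[gs go] fg]].
  exists g => //; apply: pc_base; split => // m h mo; apply: go.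
  by case: odd mo.
by exists g; split => // m h mo; apply: go; rewrite mo.
Qed.

Lemma C_even_cst (c : R) : C_even (fun _ : upoint R n => c).
Proof.
exists (fun=> c); split => //; first exact: smooth_cst.
have iter0 m :
    iter_partial (nseq m dir_rho) (fun _ : upoint R n => 0 : R) = fun=> 0.
  elim: m => //= m ->; apply/funext => p; exact: derive_cst.
case=> // m h _; rewrite -[m.+1]addn1 nseqD /iter_partial foldr_cat /=.
have -> : partial dir_rho (fun _ : upoint R n => c) = fun=> 0.
  by apply/funext => p; exact: derive_cst.
by have := iter0 m; rewrite /iter_partial => ->.
Qed.

Lemma C_even_mul f g : C_even f -> C_even g -> C_even (fun p => f p * g p).
Proof.
move=> /C_evenP[f' f'A ff'] /C_evenP[g' g'A gg']; apply/C_evenP.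
exists (fun p => f' p * g' p); first exact: (@pc_mul false false).
by move=> p p0; rewrite ff'// gg'.
Qed.

Lemma C_even_exp f : C_even f -> C_even (fun p => expR (f p)).
Proof.
move=> /C_evenP[f' f'A ff']; apply/C_evenP.
exists (fun p => expR (f' p)); first exact: pc_exp.
by move=> p p0; rewrite ff'.
Qed.

End Smooth.

(** * Restriction to the boundary *)

Section Trace.
Context {R : realType} {n : nat}.
Implicit Types (f g u w : upoint R n -> R) (p v : upoint R n) (h : heis R n).

Lemma near_at_right h u w : (forall p, 0 < rho p -> u p = w p) ->
  {near (0 : R)^'+, (fun r => u (h, r)) =1 (fun r => w (h, r))}.
Proof.
move=> uw; near=> r; apply: uw; rewrite /rho /=.
by near: r; exact: nbhs_right_gt.
Unshelve. all: by end_near. Qed.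

Lemma trace_eq u w : (forall p, 0 < rho p -> u p = w p) -> trace u = trace w.
Proof.
move=> uw; apply/funext => h; rewrite /trace; congr (lim _).
rewrite eqEsubset; split; apply: near_eq_cvg; apply: near_at_right => // p p0.
by rewrite uw.
Qed.

Lemma trace_cvg u h (l : R) : u (h, r) @[r --> 0^'+] --> l -> trace u h = l.
Proof. by move=> ul; exact: (cvg_lim (@Rhausdorff R)). Qed.

(* This also holds when the limit of [u] does not exist: [trace u h] is then
   the default value [0] of [lim], and the same goes for the product. *)
Lemma trace_mul w u h (a : R) : a != 0 -> w (h, r) @[r --> 0^'+] --> a ->
  trace (fun p => w p * u p) h = a * trace u h.
Proof.
move=> a0 wa.
have [/cvg_ex[/= l ul]|ul] := pselect (cvg (u (h, r) @[r --> 0^'+])).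
  by rewrite (trace_cvg ul); apply: trace_cvg; exact: cvgM.
rewrite [trace u h](dvgP ul) mulr0; apply: dvgP => wu; apply: ul.
have : (w (h, r))^-1 * (w (h, r) * u (h, r)) @[r --> 0^'+]
    --> a^-1 * lim ((w (h, r) * u (h, r)) @[r --> 0^'+]).
  by apply: cvgM wu; exact: cvgV.
move=> wVu; apply/cvg_ex; eexists; apply: cvg_trans wVu.
apply: near_eq_cvg; near=> r; rewrite mulKf//.
by near: r; exact: (cvgr_neq0 a wa a0).
Unshelve. all: by end_near. Qed.

(** On rho > 0 the function agrees with one that is continuous across rho = 0, so the one-sided
    limit behind [trace] exists. *)
Lemma C_even_trace f h : C_even f -> f (h, r) @[r --> 0^'+] --> trace f h.
Proof.
move=> [g [gs fg _]].
suff fl : f (h, r) @[r --> 0^'+] --> g (h, 0) by rewrite (trace_cvg fl).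
have gl : g (h, r) @[r --> (0 : R)] --> g (h, 0).
  apply: (@continuous_comp _ (upoint R n) _ (fun r : R => (h, r)) g).
    by move=> A; apply: (@cvg_pair _ _ _ (nbhs (0 : R)) (nbhs h) (nbhs (0 : R))
      _ _ _ (fun=> h) id (cvg_cst h) cvg_id).
  exact: smooth_continuous.
apply: cvg_trans (cvg_at_right_filter gl).
by apply: near_eq_cvg; apply: near_at_right => p p0; rewrite fg.
Qed.

End Trace.

Section ExpTrace.
Context {R : realType} {n : nat} (sigma : upoint R n -> R).
Context (sigma_even : C_even sigma).

Lemma cvg_expR_C_even (c : R) (h : heis R n) :
  expR (c * sigma (h, x)) @[x --> 0^'+] --> expR (c * trace sigma h).
Proof.
apply: (@cvg_comp _ _ _ (fun x : R => c * sigma (h, x)) expR).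
  by apply: cvgM; [exact: cvg_cst | exact: C_even_trace].
exact: continuous_expR.
Qed.

Lemma trace_expR_mul (c : R) u h :
  trace (fun p => expR (c * sigma p) * u p) h =
  expR (c * trace sigma h) * trace u h.
Proof.
by apply: trace_mul; [rewrite gt_eqF ?expR_gt0 | exact: cvg_expR_C_even].
Qed.

End ExpTrace.

(** * Local linear differential operators on rho > 0 *)

Section Interior.
Context {R : realType} {n : nat}.
Implicit Types (f g u : upoint R n -> R) (p v : upoint R n).

Lemma rho_near p : 0 < rho p -> \forall q \near p, 0 < rho q.
Proof.
move=> p0; have rc : {for p, continuous (fun q : upoint R n => rho q)}.
  exact: cvg_snd.
exact: (cvgr_gt (rho p) rc).
Qed.

Lemma near_interior f g p : (forall q, 0 < rho q -> f q = g q) ->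
  0 < rho p -> \forall q \near p, f q = g q.
Proof.
by move=> fg /rho_near; apply: filterS => q; exact: fg.
Qed.

Lemma partial_local v f g p : (forall q, 0 < rho q -> f q = g q) ->
  0 < rho p -> partial v f p = partial v g p.
Proof. by move=> fg p0; apply: near_eq_derive; exact: near_interior. Qed.

Lemma continuous_horizontal : continuous (fun p : upoint R n => p.1.1).
Proof.
move=> p; apply: (@continuous_comp _ (heis R n) _ (fun q => q.1) (fun q => q.1)).
  exact: cvg_fst.
exact: cvg_fst.
Qed.

Lemma smooth_yco (j : 'I_n) : smooth (@yco R n j).
Proof.
apply: smooth_linear; first by move=> p v t; rewrite /yco /= !mxE.
move=> p; apply: (@continuous_comp _ _ _ (fun q : upoint R n => q.1.1)
  (fun z : 'rV[R]_n * 'rV[R]_n => z.2 0 j)); first exact: continuous_horizontal.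
apply: (@continuous_comp _ _ _ snd (fun z : 'rV[R]_n => z 0 j)).
  exact: cvg_snd.
exact: coord_continuous.
Qed.

Lemma smooth_xco (j : 'I_n) : smooth (@xco R n j).
Proof.
apply: smooth_linear; first by move=> p v t; rewrite /xco /= !mxE.
move=> p; apply: (@continuous_comp _ _ _ (fun q : upoint R n => q.1.1)
  (fun z : 'rV[R]_n * 'rV[R]_n => z.1 0 j)); first exact: continuous_horizontal.
apply: (@continuous_comp _ _ _ fst (fun z : 'rV[R]_n => z 0 j)).
  exact: cvg_fst.
exact: coord_continuous.
Qed.

(* Only the values at [rho > 0] matter: by [interior_ext] the class contains
   the solutions furnished by scattering theory. *)
Inductive interior_smooth : (upoint R n -> R) -> Prop :=
| interior_of_smooth f : smooth f -> interior_smooth f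
| interior_pow (a : R) : interior_smooth (fun p => rho p `^ a)
| interior_add f g : interior_smooth f -> interior_smooth g ->
    interior_smooth (fun p => f p + g p)
| interior_mul f g : interior_smooth f -> interior_smooth g ->
    interior_smooth (fun p => f p * g p)
| interior_ext f g : (forall p, 0 < rho p -> f p = g p) ->
    interior_smooth f -> interior_smooth g.

Lemma is_derive_pow p v (a : R) : 0 < rho p ->
  is_derive p v (fun q => rho q `^ a) (a * rho p `^ (a - 1) * rho v).
Proof.
move=> p0; apply: (@is_derive_comp _ _ (fun x => x `^ a)).
  exact: is_derive1_powR.
by apply: is_derive_linear => t; rewrite /rho.
Qed.

Lemma interior_derivable f p v : interior_smooth f -> 0 < rho p -> derivable f p v.
Proof.
move=> fA p0; elim: fA => {f}[f fs|a|f g _ fd _ gd|f g _ fd _ gd|f g fg _].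
- exact: smooth_derivable.
- by case: (is_derive_pow v a p0).
- by case: (is_derive_add fd gd).
- by case: (is_derive_mul fd gd).
- by apply: near_eq_derivable; exact: near_interior.
Qed.

Lemma interior_cst (c : R) : interior_smooth (fun=> c).
Proof. exact/interior_of_smooth/smooth_cst. Qed.

Lemma interior_partial f v : interior_smooth f -> interior_smooth (partial v f).
Proof.
elim=> {f}[f fs|a|f g fs fd gs gd|f g fs fd gs gd|f g fg _ fd].
- exact/interior_of_smooth/smooth_partial.
- apply: (@interior_ext (fun p => a * rho p `^ (a - 1) * rho v)).
    by move=> p p0; apply/esym/partialE; exact: is_derive_pow.
  apply: interior_mul (interior_cst _).
  exact: interior_mul (interior_cst _) (interior_pow _).
- apply: interior_ext (interior_add fd gd) => p p0; apply/esym/partialE.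
  by apply: is_derive_add; exact: interior_derivable.
- have fgs := interior_add (interior_mul fs gd) (interior_mul gs fd).
  apply: interior_ext fgs => p p0.
  by apply/esym/partialE/is_derive_mul; exact: interior_derivable.
- by apply: interior_ext fd => p p0; exact: partial_local.
Qed.

(** These properties pass to sums, composites and multiples by coefficients, so they reach [Delta_B]
    and the products of the D's from [partial] alone. Locality is part of the bundle because
    identities between functions are only known on rho > 0. *)
Record local_linear (L : (upoint R n -> R) -> upoint R n -> R) : Prop :=
  LocalLinear {
  ll_smooth : forall f, interior_smooth f -> interior_smooth (L f);
  ll_local : forall f g p, (forall q, 0 < rho q -> f q = g q) ->
    0 < rho p -> L f p = L g p;
  ll_add : forall f g p, interior_smooth f -> interior_smooth g ->
    0 < rho p -> L (fun q => f q + g q) p = L f p + L g p;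
  ll_scale : forall (c : R) f p, interior_smooth f -> 0 < rho p ->
    L (fun q => c * f q) p = c * L f p
}.

Lemma ll_partial v : local_linear (partial v).
Proof.
split=> [f|f g p|f g p fs gs p0|c f p fs p0].
- exact: interior_partial.
- exact: partial_local.
- by apply/partialE/is_derive_add; exact: interior_derivable.
- apply: partialE; have fd := derivableP (interior_derivable (v := v) fs p0).
  exact: (is_deriveZ c fd).
Qed.

Lemma ll_id : local_linear id.
Proof. by split=> // f g p fg p0; exact: fg. Qed.

Lemma ll_comp L M :
  local_linear L -> local_linear M -> local_linear (fun u => L (M u)).
Proof.
move=> [Ls Ll La Lc] [Ms Ml Ma Mc].
split=> [f fs|f g p fg|f g p fs gs p0|c f p fs p0].
- exact/Ls/Ms.
- by apply: Ll => q; exact: Ml.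
- rewrite -La//; [|exact: Ms..].
  by apply: Ll => // q q0; exact: Ma.
- rewrite -Lc//; last exact: Ms.
  by apply: Ll => // q q0; exact: Mc.
Qed.

Lemma ll_plus L M : local_linear L -> local_linear M ->
  local_linear (fun u p => L u p + M u p).
Proof.
move=> [Ls Ll La Lc] [Ms Ml Ma Mc].
split=> [f fs|f g p fg p0|f g p fs gs p0|c f p fs p0].
- by apply: interior_add; [exact: Ls | exact: Ms].
- by rewrite (Ll _ g)// (Ml _ g).
- by rewrite La// Ma// addrACA.
- by rewrite Lc// Mc// mulrDr.
Qed.

Lemma ll_times w L : interior_smooth w -> local_linear L ->
  local_linear (fun u p => w p * L u p).
Proof.
move=> ws [Ls Ll La Lc]; split=> [f fs|f g p fg p0|f g p fs gs p0|c f p fs p0].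
- by apply: interior_mul => //; exact: Ls.
- by rewrite (Ll _ g).
- by rewrite La// mulrDr.
- by rewrite Lc// mulrCA.
Qed.

Lemma ll_ext L M : (forall u p, L u p = M u p) ->
  local_linear L -> local_linear M.
Proof.
by move=> LM; suff -> : M = L by []; apply/funext => u; apply/funext => p.
Qed.

Lemma ll_zero : local_linear (fun _ _ => 0).
Proof.
split=> // [f _|f g p _ _ _|c f p _ _]; first exact: interior_cst.
  by rewrite addr0.
by rewrite mulr0.
Qed.

Lemma ll_sum (I : Type) (s : seq I) L : (forall i, local_linear (L i)) ->
  local_linear (fun u p => \sum_(i <- s) L i u p).
Proof.
move=> Ll; elim: s => [|i s IH].
  by apply: ll_ext ll_zero => u p; rewrite big_nil.
by apply: ll_ext (ll_plus (Ll i) IH) => u p; rewrite big_cons.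
Qed.

(** Both conclusions are proved in one induction: additivity of [L] at the next term needs the
    smoothness of the partial sum. *)
Lemma ll_sum_arg (I : eqType) (s : seq I) (F : I -> upoint R n -> R) L p :
  local_linear L -> (forall i, i \in s -> interior_smooth (F i)) -> 0 < rho p ->
  interior_smooth (fun q => \sum_(i <- s) F i q) /\
  L (fun q => \sum_(i <- s) F i q) p = \sum_(i <- s) L (F i) p.
Proof.
move=> [Ls Ll La Lc] + p0; elim: s => [|i s IH] Fs.
  split; first by apply: interior_ext (interior_cst 0) => q _; rewrite big_nil.
  (* The empty sum is written as the multiple [0 * 0], so that homogeneity gives the value 0. *)
  rewrite big_nil (Ll _ (fun q => 0 * 0))//; last first.
    by move=> q _; rewrite big_nil mul0r.
  by rewrite Lc ?mul0r//; exact: interior_cst.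
have [sS sE] := IH (fun k ks => Fs k (mem_behead (s := i :: s) ks)).
have Fi := Fs i (mem_head i s).
split; first by apply: interior_ext (interior_add Fi sS) => q _; rewrite big_cons.
rewrite big_cons -sE -La//; apply: Ll => // q _; exact: big_cons.
Qed.

Lemma ll_X (j : 'I_n) : local_linear (X j).
Proof.
apply: ll_plus (ll_partial _) _; apply: ll_times (ll_partial _).
by apply: interior_mul (interior_cst _) _; exact/interior_of_smooth/smooth_yco.
Qed.

Lemma ll_Y (j : 'I_n) : local_linear (Y j).
Proof.
apply: (@ll_ext (fun u p => partial (dir_y j) u p
                         + (- (2 * xco j p)) * partial dir_t u p)).
  by move=> u p; rewrite mulNr.
apply: ll_plus (ll_partial _) _; apply: ll_times (ll_partial _).
apply: (@interior_ext (fun p => - 2 * xco j p)).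
  by move=> p _; rewrite mulNr.
by apply: interior_mul (interior_cst _) _; exact/interior_of_smooth/smooth_xco.
Qed.

Lemma ll_Delta_b : local_linear (@Delta_b R n).
Proof.
apply: ll_times (interior_cst _) _.
apply: (@ll_sum _ _ (fun j u p => X j (X j u) p + Y j (Y j u) p)) => j.
exact: ll_plus (ll_comp (ll_X j) (ll_X j)) (ll_comp (ll_Y j) (ll_Y j)).
Qed.

Lemma interior_rho : interior_smooth (@rho R n).
Proof.
by apply: interior_ext (interior_pow 1) => p p0; rewrite powRr1// ltW.
Qed.

Lemma ll_Delta_B : local_linear (@Delta_B R n).
Proof.
apply: (@ll_ext (fun u p => rho p ^+ 2 * ((partial dir_rho (partial dir_rho u) p
     + Delta_b u p) + rho p ^+ 2 * partial dir_t (partial dir_t u) p)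
  + (- (2 * n + 1)%:R * rho p) * partial dir_rho u p)).
  by move=> u p; rewrite !mulNr.
have r2 : interior_smooth (fun p => rho p ^+ 2).
  apply: interior_ext (interior_mul interior_rho interior_rho) => p _.
  by rewrite expr2.
apply: ll_plus; last first.
  apply: ll_times (ll_partial _); exact: interior_mul (interior_cst _) interior_rho.
apply: (ll_times r2); apply: ll_plus; last first.
  by apply: (ll_times r2); exact: ll_comp (ll_partial _) (ll_partial _).
exact: ll_plus (ll_comp (ll_partial _) (ll_partial _)) ll_Delta_b.
Qed.

Lemma ll_Dop (gamma : R) l : local_linear (@Dop R n gamma l).
Proof. exact: ll_plus ll_Delta_B (ll_times (interior_cst _) ll_id). Qed.

Lemma ll_Dprod (gamma : R) ls : local_linear (@Dprod R n gamma ls).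
Proof.
elim: ls => [|l ls IH]; first exact: ll_id.
exact: ll_comp (ll_Dop gamma l) IH.
Qed.

Lemma Dprod_eigen (gamma : R) ls u (lam : nat -> R) : interior_smooth u ->
  (forall l p, 0 < rho p -> Dop gamma l u p = lam l * u p) ->
  forall p, 0 < rho p -> Dprod gamma ls u p = \prod_(l <- ls) lam l * u p.
Proof.
move=> us uD; elim: ls => [|l ls IH] p p0 /=; first by rewrite big_nil mul1r.
rewrite (ll_local (ll_Dop gamma l) (g := fun q => \prod_(l <- ls) lam l * u q))//.
by rewrite (ll_scale (ll_Dop gamma l))// uD// big_cons mulrA (mulrC (lam l)).
Qed.

End Interior.

(** * Convergence of Euler's limit and the functional equation of Gamma *)

Section GammaFunction.
Context {R : realType}.
Implicit Types x y : R.

(** For x < 1 this is Young's inequality for (1 + y)^x and 1 with the conjugate exponents 1/x and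
    1/(1 - x). *)
Lemma powR_bernoulli x y : 0 < x <= 1 -> 0 <= 1 + y ->
  (1 + y) `^ x <= 1 + x * y.
Proof.
move=> /andP[x0]; rewrite le_eqVlt => /predU1P[-> y0|x1 y0].
  by rewrite powRr1// mul1r.
have := @conjugate_powR _ ((1 + y) `^ x) 1 x^-1 (1 - x)^-1.
rewrite !invrK powR1 -powRrM mulfV ?gt_eqF// powRr1// mulr1 mul1r.
rewrite powR_ge0 ler01 !invr_gt0 x0 subr_gt0 x1 addrC subrK.
by move=> /(_ isT isT isT isT erefl) /le_trans; apply; lra.
Qed.

Definition euler_gamma x (m : nat) : R :=
  (m`!)%:R * m%:R `^ x / \prod_(i < m.+1) (x + i%:R).

Lemma euler_prod_gt0 x m : 0 < x -> 0 < \prod_(i < m) (x + i%:R).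
Proof. by move=> x0; apply: prodr_gt0 => i _; rewrite ltr_wpDr. Qed.

(** The index starts at 1 because [euler_gamma x 0] is 0. *)
Lemma euler_gamma_gt0 x m : 0 < x -> 0 < euler_gamma x m.+1.
Proof.
move=> x0; apply: divr_gt0; last exact: euler_prod_gt0.
by rewrite mulr_gt0 ?powR_gt0 ?ltr0n ?fact_gt0.
Qed.

Lemma euler_gammaS x m : 0 < x ->
  euler_gamma x m.+2 =
  euler_gamma x m.+1 * ((m.+2%:R * (m.+2%:R / m.+1%:R) `^ x) / (x + m.+2%:R)).
Proof.
move=> x0; rewrite /euler_gamma big_ord_recr /= factS natrM.
have p0 := @euler_prod_gt0 x m.+2 x0.
rewrite powRM ?invr_ge0// -[m.+1%:R^-1]powR_inv1// -powRrM mulN1r powRN.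
have m0 : (0 : R) < m.+1%:R `^ x by rewrite powR_gt0.
have xm0 : 0 < x + (2 + m%:R) by rewrite -(natrD _ 2 m) ltr_wpDr.
by field; rewrite !gt_eqF.
Qed.

(** With N = m + 2 and t = (N / (N - 1))^x, the claim is N + x <= N t. Bernoulli's inequality for
    1/t = (1 - 1/N)^x gives N <= t (N - x). *)
Lemma euler_gamma_nondecreasing x m : 0 < x <= 1 ->
  euler_gamma x m.+1 <= euler_gamma x m.+2.
Proof.
move=> /[dup] x01 /andP[x0 x1]; rewrite euler_gammaS// ler_pMr ?euler_gamma_gt0//.
have m1 : (1 : R) <= m.+1%:R by rewrite ler1n.
have xm0 : 0 < x + m.+2%:R by rewrite ltr_wpDr.
rewrite ler_pdivlMr// mul1r.
set t := _ `^ x; have t0 : 0 < t by rewrite powR_gt0// divr_gt0.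
have tV : t^-1 <= 1 - x / m.+2%:R.
  rewrite /t -powRN -[- x]mulN1r powRrM powR_inv1 ?divr_ge0// invf_div.
  have -> : m.+1%:R / m.+2%:R = 1 + - m.+2%:R^-1 :> R.
    by rewrite -[X in X / _](addrK 1) natr1 mulrDl mulfV ?pnatr_eq0// mulNr mul1r.
  rewrite (le_trans (powR_bernoulli _ _))// ?mulrN//.
  by rewrite subr_ge0 invf_le1// ler1n.
have {}tV : m.+2%:R <= t * (m.+2%:R - x).
  rewrite -ler_pdivrMl//; have -> : m.+2%:R - x = (1 - x / m.+2%:R) * m.+2%:R.
    by rewrite mulrBl mul1r divfK ?pnatr_eq0.
  by rewrite ler_wpM2r.
have mx : 0 < m.+2%:R - x by rewrite -[m.+2%:R]natr1; lra.
(* After multiplication by N - x > 0: (x + N)(N - x) = N^2 - x^2 <= N^2 <= N t (N - x). *)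
rewrite -(ler_pM2r mx); nra.
Qed.

Lemma euler_gamma_bounded x m : 0 < x <= 1 ->
  euler_gamma x m.+1 <= euler_gamma x 1 * (1 + x).
Proof.
move=> /[dup] x01 /andP[x0 x1].
(* With this extra factor, which is at least 1, the sequence becomes nonincreasing: the step is
   Bernoulli's inequality for (1 + 1/(m + 1))^x. The right-hand side is the value at [m = 0]. *)
suff : euler_gamma x m.+1 * ((m.+1%:R + x) / m.+1%:R)
    <= euler_gamma x 1 * (1 + x).
  apply: le_trans; rewrite ler_pMr ?euler_gamma_gt0// ler_pdivlMr// mul1r lerDl.
  exact: ltW.
elim: m => [|m IH]; first by rewrite divr1.
apply: le_trans IH; rewrite euler_gammaS// -mulrA ler_pM2l ?euler_gamma_gt0//.
have xm0 : 0 < x + m.+2%:R by rewrite ltr_wpDr.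
set t := _ `^ x.
have -> : m.+2%:R * t / (x + m.+2%:R) * ((m.+2%:R + x) / m.+2%:R) = t.
  rewrite [m.+2%:R + x]addrC -mulrA (mulrA _^-1) mulVf ?gt_eqF// mul1r.
  by rewrite mulrAC mulfV ?pnatr_eq0// mul1r.
have mE : m.+2%:R / m.+1%:R = 1 + m.+1%:R^-1 :> R.
  by rewrite -natr1 mulrDl mulfV ?pnatr_eq0// mul1r.
rewrite /t mE (le_trans (powR_bernoulli _ _))//.
by rewrite mulrDl mulfV ?pnatr_eq0.
Qed.

Lemma euler_gamma_cvg01 x : 0 < x <= 1 ->
  exists2 l : R, 0 < l & euler_gamma x @ \oo --> l.
Proof.
move=> /[dup] x01 /andP[x0 x1].
have nd : nondecreasing_seq (fun m => euler_gamma x m.+1).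
  by apply/nondecreasing_seqP => m; exact: euler_gamma_nondecreasing.
have cv : cvgn (fun m => euler_gamma x m.+1).
  apply: nondecreasing_is_cvgn => //; exists (euler_gamma x 1 * (1 + x)).
  by move=> _ [m _ <-]; exact: euler_gamma_bounded.
exists (limn (fun m => euler_gamma x m.+1)).
  apply: (lt_le_trans (@euler_gamma_gt0 x 0 x0)).
  exact: (nondecreasing_cvgn_le nd cv 0%N).
by rewrite -cvg_shiftS.
Qed.

(** Shifting x by 1 shifts the factors of the denominator by one place: x is lost and x + m + 1 is
    gained. *)
Lemma euler_gamma_step x m : 0 < x ->
  euler_gamma (x + 1) m = euler_gamma x m * (x * (m%:R / (m%:R + (x + 1)))).
Proof.
move=> x0; rewrite /euler_gamma.
have -> : \prod_(i < m.+1) (x + 1 + i%:R) =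
    \prod_(i < m.+1) (x + i%:R) * (m%:R + (x + 1)) / x.
  have -> : \prod_(i < m.+1) (x + i%:R) * (m%:R + (x + 1)) =
      \prod_(i < m.+2) (x + i%:R).
    by rewrite [RHS]big_ord_recr /= -natr1; congr (_ * _); ring.
  rewrite [in RHS]big_ord_recl /= addr0 [x * _]mulrC mulfK ?gt_eqF//.
  by apply: eq_bigr => i _; rewrite /bump /= natrD addrA.
have p0 := @euler_prod_gt0 x m.+1 x0.
have m0 : 0 < m%:R + (x + 1) by rewrite ltr_wpDl ?ltr_wpDr.
rewrite powRD; last by rewrite gt_eqF ?implybT//; lra.
by rewrite powRr1//; field; rewrite !gt_eqF.
Qed.

Lemma euler_gamma_cvgS x l : 0 < x -> euler_gamma x @ \oo --> l ->
  euler_gamma (x + 1) @ \oo --> x * l.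
Proof.
move=> x0 xl.
have mc : (m%:R / (m%:R + (x + 1)) : R) @[m --> \oo] --> (1 : R).
  have -> : (fun m => m%:R / (m%:R + (x + 1)) : R) =
      (fun m => 1 - (x + 1) * (m%:R + (x + 1))^-1).
    apply/funext => m; have m0 : 0 < m%:R + (x + 1) by rewrite ltr_wpDl ?ltr_wpDr.
    by field; rewrite gt_eqF.
  rewrite -[X in _ --> X]subr0 -[X in _ - X](mulr0 (x + 1)).
  apply: cvgB; first exact: cvg_cst.
  apply: cvgM; first exact: cvg_cst.
  apply/gtr0_cvgV0; first by near=> m; rewrite ltr_wpDl ?ltr_wpDr.
  apply/cvgryPge => A; near=> m; apply: ler_wpDr; first by lra.
  by near: m; exact: nbhs_infty_ger.
have -> : euler_gamma (x + 1) =
    fun m => euler_gamma x m * (x * (m%:R / (m%:R + (x + 1)))).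
  by apply/funext => m; exact: euler_gamma_step.
rewrite -[x * l]mulr1 mulrAC mulrC.
by apply: cvgM => //; apply: cvgM => //; exact: cvg_cst.
Unshelve. all: by end_near. Qed.

(** Induction on an integer bound for x: [euler_gamma_cvgS] reduces x > 1 to x - 1, until x lies in
    (0, 1], where the sequence is monotone and bounded. *)
Lemma euler_gamma_cvg x : 0 < x ->
  exists2 l : R, 0 < l & euler_gamma x @ \oo --> l.
Proof.
have := Num.Theory.truncnS_gt x.
move: (Num.truncn x).+1 => N xN.
elim: N x xN => [x|N IH x xN x0]; first by move=> /lt_trans/[apply]; rewrite ltxx.
have [x1|x1] := leP x 1; first by apply: euler_gamma_cvg01; rewrite x0.
have [||l l0 xl] := IH (x - 1); rewrite ?subr_gt0//.
  by move: xN; rewrite -natr1; lra.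
exists ((x - 1) * l); first by rewrite mulr_gt0// subr_gt0.
rewrite -[X in euler_gamma X](subrK 1).
by apply: euler_gamma_cvgS; rewrite ?subr_gt0.
Qed.

Lemma Gamma_gt0 x : 0 < x -> 0 < Gamma x.
Proof.
move=> /euler_gamma_cvg[l l0 xl].
by rewrite /Gamma (cvg_lim (@Rhausdorff R) xl).
Qed.

Lemma GammaS x : 0 < x -> Gamma (x + 1) = x * Gamma x.
Proof.
move=> x0; have [l l0 xl] := euler_gamma_cvg x0.
rewrite /Gamma (cvg_lim (@Rhausdorff R) xl).
by rewrite (cvg_lim (@Rhausdorff R) (euler_gamma_cvgS x0 xl)).
Qed.

Lemma Gamma_ratio x y (m : nat) : 0 < x -> y = x + m%:R ->
  Gamma y / Gamma x = \prod_(i < m) (x + i%:R).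
Proof.
move=> x0 ->; elim: m => [|m IH].
  by rewrite addr0 big_ord0 mulfV// gt_eqF// Gamma_gt0.
rewrite -natr1 addrA GammaS; last by rewrite ltr_wpDr.
by rewrite -mulrA IH big_ord_recr /= mulrC.
Qed.

End GammaFunction.

(** * The constants b as products of eigenvalues *)

Section Constants.
Context {R : realType} {gamma : R}.
Context (gamma_gt0 : 0 < gamma) (gammaN : gamma \isn't a Num.nat).
Notation fl := (fl gamma).
Notation flh := (flh gamma).
Notation frac := (Defs.frac gamma).

Lemma gammaE : gamma = fl%:R + frac.
Proof. by rewrite /Defs.frac addrC subrK. Qed.

Lemma frac_gt0 : 0 < frac.
Proof.
rewrite subr_gt0 lt_neqAle; have /andP[-> _] := truncn_itv (ltW gamma_gt0).
by rewrite andbT; move: gammaN; rewrite natrEtruncn.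
Qed.

Lemma frac_lt1 : frac < 1.
Proof.
have /andP[_] := truncn_itv (ltW gamma_gt0).
by rewrite -natr1 ltrBlDl.
Qed.

(** Together with [fl_le] this says that [fl] is [flh.*2] or [flh.*2.+1], which is what the index
    estimates for the boundary operators rest on. *)
Lemma flh_le : (flh.*2 <= fl)%N.
Proof.
rewrite -ltnS -(ltr_nat R); have := frac_lt1; have := gammaE.
have /andP[+ _] := truncn_itv (ltW (divr_gt0 gamma_gt0 (ltr0Sn R 1))).
rewrite -/flh -muln2 natrM -[fl.+1%:R]natr1; lra.
Qed.

Lemma fl_le : (fl <= flh.*2.+1)%N.
Proof.
rewrite -ltnS -(ltr_nat R); have := frac_gt0; have := gammaE.
have /andP[_] := truncn_itv (ltW (divr_gt0 gamma_gt0 (ltr0Sn R 1))).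
rewrite -/flh -[flh.+1%:R]natr1 -[flh.*2.+2%:R]natr1 -[flh.*2.+1%:R]natr1.
by rewrite -muln2 natrM; lra.
Qed.

(* Eigenvalues of [D_{s-l}] on the solutions with scattering parameters
   [s_ev i] and [s_od i]. *)
Definition lam_ev (i l : nat) : R :=
  4 * (l%:R - i%:R) * (gamma - i%:R - l%:R).
Definition lam_od (i l : nat) : R :=
  4 * (l%:R - i%:R - frac) * (fl%:R - i%:R - l%:R).

Lemma big_iota (F : nat -> R) (m j : nat) :
  \prod_(l <- iota m j) F l = \prod_(i < j) F (m + i)%N.
Proof.
rewrite -[m in LHS]addn0 iotaDl big_map.
rewrite -(big_mkord xpredT (fun i => F (m + i)%N)).
by rewrite /index_iota subn0.
Qed.

Lemma big_iota_rev (F : nat -> R) (j : nat) :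
  \prod_(l <- iota 0 j) F l = \prod_(i < j) F (j - i.+1)%N.
Proof. by rewrite big_iota (reindex_inj rev_ord_inj). Qed.

Lemma natr_fact (j : nat) : (j`!)%:R = \prod_(i < j) (i.+1%:R : R).
Proof.
elim: j => [|j IH]; first by rewrite big_ord0.
by rewrite big_ord_recr /= -IH factS natrM mulrC.
Qed.

Lemma expr_prod (c : R) (j : nat) : c ^+ j = \prod_(i < j) c.
Proof. by rewrite prodr_const card_ord. Qed.

(** Each quotient of Gamma values is a product of j consecutive factors. The eigenvalue at l = j - i
    - 1 is -4 (i + 1)(gamma + 1 - 2j + i), the one at l = fl - j + 1 + i is -4 (fl + 1 - 2j + i)(1 -
    frac + i), and multiplying them in pairs cancels the signs. *)
Lemma b_ev_loE (j : nat) : (j.*2 <= fl)%N ->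
  b_ev_lo gamma j =
  \prod_(l <- iota 0 j ++ iota (fl - j + 1) j) lam_ev j l.
Proof.
move=> j2; have jfl : (j%:R + j%:R <= fl%:R :> R) by rewrite -natrD addnn ler_nat.
have f0 := frac_gt0; have f1 := frac_lt1; have gE := gammaE.
rewrite /b_ev_lo -mulrA -!mulf_div.
rewrite (@Gamma_ratio _ (gamma + 1 - 2 * j%:R) _ j); [|lra|lra].
rewrite (@Gamma_ratio _ (fl%:R + 1 - 2 * j%:R) _ j); [|lra|lra].
rewrite (@Gamma_ratio _ (1 - frac) _ j); [|lra|lra].
rewrite big_cat /= big_iota_rev big_iota exprM expr_prod natr_fact -!big_split /=.
apply: eq_bigr => i _; rewrite /lam_ev.
have ij : (i < j)%N by [].
rewrite natrB// !natrD natrB; last by lia.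
rewrite -[i.+1%:R]natr1 [X in _ = _ * (_ * (X - _ - _))]gE; ring.
Qed.

(** The two blocks have lengths j + 1 and j, so they are evaluated separately instead of in pairs.
    The odd number 2j + 1 of factors -4 accounts for the sign of [b_od_lo]. *)
Lemma b_od_loE (j : nat) : (j.*2 < fl)%N ->
  b_od_lo gamma j =
  \prod_(l <- iota 0 j.+1 ++ iota (fl - j + 1) j) lam_od j l.
Proof.
move=> j2; have jfl : (j%:R + j%:R + 1 <= fl%:R :> R).
  by rewrite -natrD natr1 addnn ler_nat.
have f0 := frac_gt0; have f1 := frac_lt1.
rewrite /b_od_lo -mulrA -!mulf_div.
rewrite (@Gamma_ratio _ frac _ j.+1); [|lra|by rewrite -natr1; lra].
rewrite (@Gamma_ratio _ (fl%:R - 2 * j%:R) _ j.+1); [|lra|by rewrite -natr1; lra].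
rewrite (@Gamma_ratio _ (fl%:R + 1 - 2 * j%:R - frac) _ j); [|lra|lra].
rewrite big_cat /= -[X in _ = X * _]/(\prod_(l <- iota 0 j.+1) lam_od j l).
have -> : \prod_(l <- iota 0 j.+1) lam_od j l =
    \prod_(i < j.+1) (-4) * \prod_(i < j.+1) (frac + i%:R)
    * \prod_(i < j.+1) (fl%:R - 2 * j%:R + i%:R).
  rewrite big_iota_rev -!big_split /=; apply: eq_bigr => i _; rewrite /lam_od.
  by rewrite subSS natrB -1?ltnS//; ring.
have -> : \prod_(l <- iota (fl - j + 1) j) lam_od j l =
    \prod_(i < j) (-4) * \prod_(i < j) i.+1%:R
    * \prod_(i < j) (fl%:R + 1 - 2 * j%:R - frac + i%:R).
  rewrite big_iota -!big_split /=; apply: eq_bigr => i _; rewrite /lam_od.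
  by rewrite !natrD natrB -?[i.+1%:R]natr1; [ring | lia].
rewrite -!expr_prod -natr_fact addn1 exprS exprM [(-4) ^+ j.+1]exprS.
have -> : (4 ^+ 2) ^+ j = (-4) ^+ j * (-4) ^+ j :> R.
  by rewrite -exprMn; congr (_ ^+ _); ring.
ring.
Qed.

Lemma b_ev_lo_neq0 (j : nat) : (j.*2 <= fl)%N -> b_ev_lo gamma j != 0.
Proof.
move=> j2; have jfl : (j%:R + j%:R <= fl%:R :> R) by rewrite -natrD addnn ler_nat.
have f0 := frac_gt0; have f1 := frac_lt1; have gE := gammaE.
have j0 : 0 <= j%:R :> R by [].
rewrite gt_eqF// divr_gt0//.
  rewrite mulr_gt0 ?mulr_gt0 ?exprn_gt0 ?ltr0n ?fact_gt0 ?Gamma_gt0//; lra.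
by rewrite mulr_gt0 ?mulr_gt0 ?Gamma_gt0//; lra.
Qed.

Lemma b_od_lo_neq0 (j : nat) : (j.*2 < fl)%N -> b_od_lo gamma j != 0.
Proof.
move=> j2; have jfl : (j%:R + j%:R + 1 <= fl%:R :> R).
  by rewrite -natrD natr1 addnn ler_nat.
have f0 := frac_gt0; have f1 := frac_lt1; have j0 : 0 <= j%:R :> R by [].
rewrite oppr_eq0 gt_eqF// divr_gt0//.
  rewrite mulr_gt0 ?mulr_gt0 ?exprn_gt0 ?ltr0n ?fact_gt0 ?Gamma_gt0//; lra.
by rewrite mulr_gt0 ?mulr_gt0 ?Gamma_gt0//; lra.
Qed.

End Constants.

(** * Transport of unique choice *)

Section The.

Lemma theP (T : choiceType) (d x : T) (P : set T) :
  unique P x -> the d P = x.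
Proof.
move=> [Px xu]; apply: xget_unique; first by split.
by move=> y [Py _]; rewrite (xu y Py).
Qed.

(** A bijection carrying P onto Q preserves unique existence. If it fails, both sides are defaults,
    and [phi d = d] makes them agree. *)
Lemma the_map (T : choiceType) (d : T) (phi psi : T -> T) (P Q : set T) :
  cancel phi psi -> cancel psi phi -> (forall x, P x <-> Q (phi x)) ->
  phi d = d -> the d Q = phi (the d P).
Proof.
move=> phiK psiK PQ phid.
have uPQ x : unique P x -> unique Q (phi x).
  move=> [Px xu]; split; first exact/PQ.
  by move=> y; rewrite -[y]psiK => /PQ/xu ->.
have [[x Px]|nP] := pselect (exists x, unique P x).
  by rewrite (theP d Px); apply: theP; exact: uPQ.
rewrite /the (xgetPN d (P := [set x | unique P x])).
  rewrite phid; apply: xgetPN => y [Qy yu]; apply: nP; exists (psi y).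
  split; first by apply/PQ; rewrite psiK.
  by move=> z /PQ/yu ->; rewrite phiK.
by move=> x Px; apply: nP; exists x.
Qed.

End The.

(** * Scattering solutions: boundary asymptotics and rescaling *)

Section Poisson.
Context {R : realType} {n : nat}.
Implicit Types (u F G r : upoint R n -> R) (p : upoint R n) (h : heis R n).

Lemma expR_powR (x a : R) : expR x `^ a = expR (a * x).
Proof. by rewrite mulrC expRM. Qed.

Lemma powR_half_sqr (x a : R) : 0 < x ->
  (x ^+ 2 / 2) `^ a = 2 `^ (- a) * x `^ (2 * a).
Proof.
move=> x0; rewrite powRM ?invr_ge0 ?sqr_ge0// -powR_mulrn ?ltW// -powRrM mulrC.
by rewrite -[2^-1]powR_inv1// -powRrM mulN1r.
Qed.

Lemma scattering_rhoE s f u F G p : scattering rho s f u F G -> 0 < rho p ->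
  u p = 2 `^ (- (n.+1%:R - s)) * rho p `^ (2 * (n.+1%:R - s)) * F p
      + 2 `^ (- s) * rho p `^ (2 * s) * G p.
Proof. by move=> S p0; rewrite (scattering_exp S p0) !powR_half_sqr. Qed.

Lemma interior_C_even F : C_even F -> interior_smooth F.
Proof.
move=> [g [gs Fg _]].
by apply: interior_ext (interior_of_smooth gs) => p p0; rewrite Fg.
Qed.

Lemma interior_poisson s f u : is_poisson rho s f u -> interior_smooth u.
Proof.
move=> [F [G S]].
have Fs := interior_C_even (scattering_F S).
have Gs := interior_C_even (scattering_G S).
have powc (c a : R) : interior_smooth (fun p => c * rho p `^ a).
  exact: interior_mul (interior_cst _) (interior_pow _).
apply: interior_ext (interior_add (interior_mul (powc _ _) Fs)
  (interior_mul (powc _ _) Gs)) => p p0.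
by rewrite (scattering_rhoE S p0).
Qed.

Lemma powR_mul_cvg0 (e : R) (k : R -> R) (l : R) : 0 < e ->
  k x @[x --> 0^'+] --> l -> x `^ e * k x @[x --> 0^'+] --> 0.
Proof. by move=> e0 kl; have := cvgM (powR_cvg0 e0) kl; rewrite mul0r; apply. Qed.

(** The expansion in powers of rho along the vertical line over [h]. The limit of x^e u is then read
    off from the signs of the two exponents, as in [poisson_cvg0] and [poisson_cvg]. *)
Lemma poisson_split s f u e h : is_poisson rho s f u ->
  exists2 FG : (upoint R n -> R) * (upoint R n -> R),
    [/\ C_even FG.1, C_even FG.2 & trace FG.1 = f] &
    \forall x \near (0 : R)^'+, x `^ e * u (h, x) =
      2 `^ (- (n.+1%:R - s)) * (x `^ (e + 2 * (n.+1%:R - s)) * FG.1 (h, x))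
      + 2 `^ (- s) * (x `^ (e + 2 * s) * FG.2 (h, x)).
Proof.
move=> [F [G S]]; exists (F, G).
  by split; [exact: scattering_F S|exact: scattering_G S|exact: scattering_data S].
near=> x; have x0 : 0 < x by near: x; exact: nbhs_right_gt.
rewrite (scattering_rhoE S)//= /rho /=.
by rewrite !powRD ?(gt_eqF x0) ?implybT//; ring.
Unshelve. all: by end_near. Qed.

Lemma poisson_cvg0 s f u e h : is_poisson rho s f u ->
  0 < e + 2 * (n.+1%:R - s) -> 0 < e + 2 * s ->
  x `^ e * u (h, x) @[x --> 0^'+] --> 0.
Proof.
move=> /(poisson_split e h)[[F G] [/= Fe Ge _] uE] e1 e2.
have : 2 `^ (- (n.+1%:R - s)) * (x `^ (e + 2 * (n.+1%:R - s)) * F (h, x))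
      + 2 `^ (- s) * (x `^ (e + 2 * s) * G (h, x)) @[x --> 0^'+]
     --> 2 `^ (- (n.+1%:R - s)) * 0 + 2 `^ (- s) * 0.
  by apply: cvgD; apply: cvgM; (try exact: cvg_cst); apply: powR_mul_cvg0 => //;
    apply: C_even_trace.
rewrite !mulr0 addr0; apply: cvg_trans; apply: near_eq_cvg.
by apply: filterS uE => x ->.
Qed.

Lemma poisson_cvg s f u e h : is_poisson rho s f u ->
  e + 2 * (n.+1%:R - s) = 0 -> 0 < e + 2 * s ->
  x `^ e * u (h, x) @[x --> 0^'+] --> 2 `^ (- (n.+1%:R - s)) * f h.
Proof.
move=> /(poisson_split e h)[[F G] [/= Fe Ge <-] uE] e1 e2.
have : 2 `^ (- (n.+1%:R - s)) * (x `^ (e + 2 * (n.+1%:R - s)) * F (h, x))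
      + 2 `^ (- s) * (x `^ (e + 2 * s) * G (h, x)) @[x --> 0^'+]
     --> 2 `^ (- (n.+1%:R - s)) * (1 * trace F h) + 2 `^ (- s) * 0.
  apply: cvgD; apply: cvgM; (try exact: cvg_cst).
    apply: cvgM; last exact: C_even_trace.
    under eq_cvg do rewrite e1 powRr0.
    exact: cvg_cst.
  by apply: powR_mul_cvg0 => //; exact: C_even_trace.
rewrite mul1r !mulr0 addr0; apply: cvg_trans; apply: near_eq_cvg.
by apply: filterS uE => x ->.
Qed.

Lemma poisson_scale s f u (c : R) : is_poisson rho s f u ->
  is_poisson rho s (fun h => c * f h) (fun p => c * u p).
Proof.
move=> P; have us := interior_poisson P; case: P => F [G S].
exists (fun p => c * F p), (fun p => c * G p); split.
- by move=> p p0; rewrite (scattering_out S p0) mulr0.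
- move=> p p0; rewrite (ll_scale (ll_Delta_B (R := R) (n := n)))//.
  by rewrite mulrCA -mulrDr (scattering_eq S p0) mulr0.
- by move=> p p0; rewrite (scattering_exp S p0); ring.
- by apply: C_even_mul (C_even_cst c) _; exact: scattering_F S.
- by apply: C_even_mul (C_even_cst c) _; exact: scattering_G S.
- apply/funext => h; rewrite -(scattering_data S); apply: trace_cvg.
  by apply: cvgM; [exact: cvg_cst | apply: C_even_trace; exact: scattering_F S].
(* Dividing by |c| + 1 instead of |c| covers c = 0. *)
- move=> e e0; have c1 : 0 < `|c| + 1 by rewrite ltr_wpDl.
  have [M uM] := scattering_decay S (divr_gt0 e0 c1).
  exists M => p p0 /(uM p p0); rewrite ltr_pdivlMr// => ue.
  rewrite mulrCA normrM; apply: le_lt_trans ue; rewrite mulrC ler_wpM2l//.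
  by rewrite lerDl.
Qed.

(** The solution u is kept: its equation, decay and values outside the domain do not involve the
    defining function. In the expansion, (r2^2/2)^a is e^(2 a sigma) (r1^2/2)^a, and the
    exponentials are absorbed into F and G. *)
Lemma scattering_rescale (r1 r2 sigma : upoint R n -> R) s f u F G :
  C_even sigma -> (forall p, 0 < rho p -> 0 <= r1 p) ->
  (forall p, 0 < rho p -> r2 p = expR (sigma p) * r1 p) ->
  scattering r2 s f u F G ->
  scattering r1 s (fun h => expR (2 * (n.+1%:R - s) * trace sigma h) * f h) u
    (fun p => expR (2 * (n.+1%:R - s) * sigma p) * F p)
    (fun p => expR (2 * s * sigma p) * G p).
Proof.
move=> se r10 r12 S.
have ee (c : R) : C_even (fun p => expR (c * sigma p)).
  by apply: C_even_exp; apply: C_even_mul => //; exact: C_even_cst.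
split.
- exact: scattering_out S.
- exact: scattering_eq S.
- move=> p p0; rewrite (scattering_exp S p0) r12//.
  have -> : (expR (sigma p) * r1 p) ^+ 2 / 2 =
      expR (2 * sigma p) * (r1 p ^+ 2 / 2).
    by rewrite exprMn -expRM_natl mulrA.
  have powE a : (expR (2 * sigma p) * (r1 p ^+ 2 / 2)) `^ a =
      (r1 p ^+ 2 / 2) `^ a * expR (2 * a * sigma p).
    by rewrite powRM ?expR_ge0 ?divr_ge0 ?sqr_ge0// expR_powR mulrC mulrCA mulrA.
  by rewrite !powE !mulrA.
- by apply: C_even_mul => //; exact: scattering_F S.
- by apply: C_even_mul => //; exact: scattering_G S.
- by apply/funext => h; rewrite -(scattering_data S) trace_expR_mul.
- exact: scattering_decay S.
Qed.

End Poisson.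

(** * Limits of finite sums and of their coefficients *)

Section Sums.
Context {R : realType}.

Lemma cvg_sum_nat (T : Type) (FF : set_system T) (N : nat) (k : nat -> T -> R)
    (l : nat -> R) : Filter FF ->
  (forall i, (i < N)%N -> k i x @[x --> FF] --> l i) ->
  \sum_(0 <= i < N) k i x @[x --> FF] --> \sum_(0 <= i < N) l i.
Proof.
move=> FFF; elim: N => [|N IH] kl.
  rewrite big_nil; under eq_cvg do rewrite big_nil.
  exact: cvg_cst.
rewrite big_nat_recr//=; under eq_cvg do rewrite big_nat_recr//=.
apply: cvgD; last exact: kl.
by apply: IH => i iN; apply: kl; exact: ltnW.
Qed.

Lemma sum_nat_delta (N j : nat) (c : R) : (j < N)%N ->
  \sum_(0 <= i < N) (if i == j then c else 0) = c.
Proof. by move=> jN; rewrite -big_mkcond big_nat1_eq /= jN. Qed.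

Lemma prod_eq0_in (ls : seq nat) (lam : nat -> R) l : l \in ls -> lam l = 0 ->
  \prod_(i <- ls) lam i = 0.
Proof.
move=> ll l0; apply/eqP; rewrite prodf_seq_eq0.
by apply/hasP; exists l; rewrite ?l0 /=.
Qed.

Lemma cvg_kill (e c : R) (k : R -> R) : c = 0 ->
  x `^ e * (c * k x) @[x --> (0:R)^'+] --> (0 : R).
Proof.
by move=> ->; under eq_cvg do rewrite mul0r mulr0; exact: cvg_cst.
Qed.

Lemma cvg_coef (e c l : R) (k : R -> R) :
  x `^ e * k x @[x --> (0:R)^'+] --> l ->
  x `^ e * (c * k x) @[x --> (0:R)^'+] --> c * l.
Proof.
by move=> kl; under eq_cvg do rewrite mulrCA; apply: cvgM => //; exact: cvg_cst.
Qed.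

Lemma cvg_coef0 (e c : R) (k : R -> R) :
  x `^ e * k x @[x --> (0:R)^'+] --> (0 : R) ->
  x `^ e * (c * k x) @[x --> (0:R)^'+] --> (0 : R).
Proof. by move=> /(@cvg_coef e c); rewrite mulr0. Qed.

End Sums.

(** * Lower boundary operators on sums of scattering solutions *)

Section Boundary.
Context {R : realType} {n : nat} {gamma : R}.
Context (gamma_gt0 : 0 < gamma) (gammaN : gamma \isn't a Num.nat).
Notation fl := (fl gamma).
Notation flh := (flh gamma).
Notation frac := (Defs.frac gamma).
Notation s_ev := (s_ev (n := n) gamma).
Notation s_od := (s_od (n := n) gamma).
Notation lam_ev := (lam_ev (gamma := gamma)).
Notation lam_od := (lam_od (gamma := gamma)).
Notation scaled := (scaled gamma).
Notation Dprod := (Dprod gamma).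
Implicit Types (V W u F G r : upoint R n -> R) (p : upoint R n) (h : heis R n).

(** Puts the operator of index 0, a bare trace, in the form of the others, with an empty product of
    D's. *)
Lemma trace_scaled_cst V h :
  trace (fun p => rho p `^ (- n.+1%:R + gamma) * scaled rho V p) h = trace V h.
Proof.
congr (_ h); apply: trace_eq => p p0.
rewrite /Defs.scaled mulrA -powRD ?(gt_eqF p0) ?implybT//.
by rewrite (_ : - n.+1%:R + gamma + (n.+1%:R - gamma) = 0) ?powRr0 ?mul1r//; ring.
Qed.

Section Decomposition.
Context (f g : nat -> heis R n -> R) (u v : nat -> upoint R n -> R).
Context (S : upoint R n -> R).
Context (uP : forall j, (j <= flh)%N -> is_poisson rho (s_ev j) (f j) (u j)).
Context (vP : forall j, (j < fl - flh)%N ->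
  is_poisson rho (s_od j) (g j) (v j)).
Context (SE : forall p, 0 < rho p ->
  S p = \sum_(0 <= j < flh.+1) u j p + \sum_(0 <= j < fl - flh) v j p).

Lemma Dprod_poisson_ev ls j p : (j <= flh)%N -> 0 < rho p ->
  Dprod ls (u j) p = \prod_(l <- ls) lam_ev j l * u j p.
Proof.
move=> jflh; apply: Dprod_eigen; first exact: interior_poisson (uP jflh).
move=> l q q0; have [F [G S']] := uP jflh; have := scattering_eq S' q0.
move=> /(canRL (addrK _)); rewrite /Dop => ->.
by rewrite /lam_ev /Defs.s_ev /ss; field.
Qed.

Lemma Dprod_poisson_od ls j p : (j < fl - flh)%N -> 0 < rho p ->
  Dprod ls (v j) p = \prod_(l <- ls) lam_od j l * v j p.
Proof.
move=> jfl; apply: Dprod_eigen; first exact: interior_poisson (vP jfl).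
move=> l q q0; have [F [G S']] := vP jfl; have := scattering_eq S' q0.
move=> /(canRL (addrK _)); rewrite /Dop => ->.
have -> : ss gamma (n := n) = (n.+1%:R + (fl%:R + frac)) / 2 by rewrite -gammaE.
by rewrite /lam_od /Defs.s_od; field.
Qed.

Lemma Dprod_sum ls p : 0 < rho p -> Dprod ls S p =
  \sum_(0 <= j < flh.+1) \prod_(l <- ls) lam_ev j l * u j p
  + \sum_(0 <= j < fl - flh) \prod_(l <- ls) lam_od j l * v j p.
Proof.
move=> p0; have D := ll_Dprod (n := n) gamma ls.
have us j : j \in index_iota 0 flh.+1 -> interior_smooth (u j).
  by rewrite mem_index_iota => /= jflh; exact: interior_poisson (uP jflh).
have vs j : j \in index_iota 0 (fl - flh) -> interior_smooth (v j).
  by rewrite mem_index_iota => /= jfl; exact: interior_poisson (vP jfl).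
have [us' uE] := ll_sum_arg D us p0; have [vs' vE] := ll_sum_arg D vs p0.
rewrite (ll_local D SE p0) (ll_add D)// uE vE; congr (_ + _).
  by apply: eq_big_nat => j /= jflh; exact: Dprod_poisson_ev.
by apply: eq_big_nat => j /= jfl; exact: Dprod_poisson_od.
Qed.

Lemma trace_Dprod_sum ls (e : R) (l1 l2 : nat -> R) h :
  (forall i, (i < flh.+1)%N ->
     x `^ e * (\prod_(l <- ls) lam_ev i l * u i (h, x))
       @[x --> 0^'+] --> l1 i) ->
  (forall i, (i < fl - flh)%N ->
     x `^ e * (\prod_(l <- ls) lam_od i l * v i (h, x))
       @[x --> 0^'+] --> l2 i) ->
  trace (fun p => rho p `^ e * Dprod ls S p) h =
  \sum_(0 <= i < flh.+1) l1 i + \sum_(0 <= i < fl - flh) l2 i.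
Proof.
move=> c1 c2; rewrite (trace_eq (w := fun p =>
  \sum_(0 <= j < flh.+1)
      rho p `^ e * (\prod_(l <- ls) lam_ev j l * u j p)
  + \sum_(0 <= j < fl - flh)
      rho p `^ e * (\prod_(l <- ls) lam_od j l * v j p))); last first.
  by move=> p p0; rewrite Dprod_sum// mulrDr !mulr_sumr.
by apply: trace_cvg; apply: cvgD; exact: cvg_sum_nat.
Qed.

(** Even terms with i < j are killed by the factor l = i, odd terms with i < j by l = fl - i. After
    multiplication by the outer power, even terms with i > j start at order 2(i - j) and odd terms
    with i >= j at order 2(i - j) + 2 frac, so only the even term j survives. The G parts vanish
    because i + j is small compared with gamma or [fl]. *)
Lemma trace_ev j h : (j <= flh)%N ->
  trace (fun p => rho p `^ (- n.+1%:R + gamma - 2 * j%:R)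
    * Dprod (iota 0 j ++ iota (fl - j + 1) j) S p) h =
  b_ev_lo gamma j * (2 `^ (- (n.+1%:R - s_ev j)) * f j h).
Proof.
move=> jflh.
have f0 := frac_gt0 gamma_gt0 gammaN; have f1 := frac_lt1 gamma_gt0.
have gE := gammaE (gamma := gamma); have flh2 := flh_le gamma_gt0.
have fl2 := fl_le gamma_gt0 gammaN.
set c := b_ev_lo _ _; set d := 2 `^ _ * _.
rewrite (trace_Dprod_sum (l1 := fun i => if i == j then c * d else 0)
  (l2 := fun=> 0)).
- by rewrite sum_nat_delta// big1_eq addr0.
- move=> i iflh; case: eqP => [->|/eqP ij].
    rewrite /c b_ev_loE//; last by lia.
    apply: cvg_coef; apply: poisson_cvg (uP jflh) _ _.
      by rewrite /Defs.s_ev; field.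
    have : (j%:R + j%:R <= fl%:R :> R) by rewrite -natrD ler_nat; lia.
    by rewrite /Defs.s_ev; lra.
  have [ltij|leji] := ltnP i j.
    apply: cvg_kill; apply: (@prod_eq0_in _ _ _ i).
      by rewrite mem_cat mem_iota; lia.
    by rewrite /lam_ev subrr mulr0 mul0r.
  have jR : (j%:R + 1 <= i%:R :> R) by rewrite natr1 ler_nat; lia.
  have iR : (i%:R + j%:R <= fl%:R :> R) by rewrite -natrD ler_nat; lia.
  by apply: cvg_coef0; apply: poisson_cvg0 (uP iflh) _ _; rewrite /Defs.s_ev; lra.
- move=> i ifl; have [ltij|leji] := ltnP i j.
    (* Since i < j, the index fl - i lies in the second block, which runs from fl - j + 1 to fl. *)
    apply: cvg_kill; apply: (@prod_eq0_in _ _ _ (fl - i)%N).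
      by rewrite mem_cat !mem_iota; lia.
    by rewrite /lam_od natrB ?subrr ?mulr0//; lia.
  have jR : (j%:R <= i%:R :> R) by rewrite ler_nat.
  have iR : (i%:R + j%:R + 1 <= fl%:R :> R) by rewrite -natrD natr1 ler_nat; lia.
  by apply: cvg_coef0; apply: poisson_cvg0 (vP ifl) _ _; rewrite /Defs.s_od; lra.
Qed.

(** As for [trace_ev], but the first block has the further index j. It removes the even term j,
    which the outer power would leave at order -2 frac; even terms with i > j have order 2(i - j) -
    2 frac > 0 since frac < 1. *)
Lemma trace_od j h : (j < fl - flh)%N ->
  trace (fun p => rho p `^ (- n.+1%:R + gamma - 2 * j%:R - 2 * frac)
    * Dprod (iota 0 j.+1 ++ iota (fl - j + 1) j) S p) h =
  b_od_lo gamma j * (2 `^ (- (n.+1%:R - s_od j)) * g j h).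
Proof.
move=> jfl.
have f0 := frac_gt0 gamma_gt0 gammaN; have f1 := frac_lt1 gamma_gt0.
have gE := gammaE (gamma := gamma); have flh2 := flh_le gamma_gt0.
have fl2 := fl_le gamma_gt0 gammaN.
set c := b_od_lo _ _; set d := 2 `^ _ * _.
rewrite (trace_Dprod_sum (l1 := fun=> 0)
  (l2 := fun i => if i == j then c * d else 0)).
- by rewrite sum_nat_delta// big1_eq add0r.
- move=> i iflh; have [ltij|leji] := leqP i j.
    apply: cvg_kill; apply: (@prod_eq0_in _ _ _ i).
      by rewrite mem_cat mem_iota; lia.
    by rewrite /lam_ev subrr mulr0 mul0r.
  have jR : (j%:R + 1 <= i%:R :> R) by rewrite natr1 ler_nat; lia.
  have iR : (i%:R + j%:R + 1 <= fl%:R :> R) by rewrite -natrD natr1 ler_nat; lia.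
  by apply: cvg_coef0; apply: poisson_cvg0 (uP iflh) _ _; rewrite /Defs.s_ev; lra.
- move=> i ifl; have iR : (i%:R + j%:R + 1 <= fl%:R :> R).
    by rewrite -natrD natr1 ler_nat; lia.
  case: eqP => [ij|/eqP ij].
    rewrite /c b_od_loE//; last by lia.
    rewrite ij; apply: cvg_coef; apply: poisson_cvg (vP jfl) _ _.
      by rewrite /Defs.s_od [X in - _ + X]gE; field.
    by move: iR; rewrite ij /Defs.s_od; lra.
  have [ltij|leji] := ltnP i j.
    apply: cvg_kill; apply: (@prod_eq0_in _ _ _ (fl - i)%N).
      by rewrite mem_cat !mem_iota; lia.
    by rewrite /lam_od natrB ?subrr ?mulr0//; lia.
  have jR : (j%:R + 1 <= i%:R :> R) by rewrite natr1 ler_nat; lia.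
  by apply: cvg_coef0; apply: poisson_cvg0 (vP ifl) _ _; rewrite /Defs.s_od; lra.
Qed.

(** The indices 0, ..., fl contain a zero eigenvalue for every term: l = i for the even ones and l =
    fl - i for the odd ones. *)
Lemma Dprod_kill p : 0 < rho p -> Dprod (iota 0 (kk gamma)) S p = 0.
Proof.
move=> p0; rewrite Dprod_sum//; have flh2 := flh_le gamma_gt0.
rewrite !big1_seq ?addr0// => i; rewrite mem_index_iota => ifl.
  rewrite (@prod_eq0_in _ _ _ (fl - i)%N) ?mul0r//.
    by rewrite mem_iota /kk; lia.
  by rewrite /lam_od natrB ?subrr ?mulr0//; lia.
rewrite (@prod_eq0_in _ _ _ i) ?mul0r//; first by rewrite mem_iota /kk; lia.
by rewrite /lam_ev subrr mulr0 mul0r.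
Qed.

End Decomposition.

Lemma B_ev_lo_sum (f g : nat -> heis R n -> R)
    (u v : nat -> upoint R n -> R) W j h :
  (forall j, (j <= flh)%N -> is_poisson rho (s_ev j) (f j) (u j)) ->
  (forall j, (j < fl - flh)%N -> is_poisson rho (s_od j) (g j) (v j)) ->
  (forall p, 0 < rho p -> scaled rho W p =
     \sum_(0 <= j < flh.+1) u j p + \sum_(0 <= j < fl - flh) v j p) ->
  (j <= flh)%N ->
  B_ev_lo gamma rho j W h = 2 `^ (- (n.+1%:R - s_ev j)) * f j h.
Proof.
move=> uP vP WE jflh; have := trace_ev uP vP WE h jflh.
have b0 : b_ev_lo gamma j != 0.
  by apply: b_ev_lo_neq0 => //; have := flh_le gamma_gt0; lia.
rewrite /B_ev_lo; case: eqP => [j0|_]; last by move=> ->; rewrite mulKf.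
rewrite j0 mulr0 subr0 /= trace_scaled_cst => ->.
by rewrite b_ev_loE ?big_nil ?mul1r.
Qed.

Lemma B_od_lo_sum (f g : nat -> heis R n -> R)
    (u v : nat -> upoint R n -> R) W j h :
  (forall j, (j <= flh)%N -> is_poisson rho (s_ev j) (f j) (u j)) ->
  (forall j, (j < fl - flh)%N -> is_poisson rho (s_od j) (g j) (v j)) ->
  (forall p, 0 < rho p -> scaled rho W p =
     \sum_(0 <= j < flh.+1) u j p + \sum_(0 <= j < fl - flh) v j p) ->
  (j < fl - flh)%N ->
  B_od_lo gamma rho j W h = 2 `^ (- (n.+1%:R - s_od j)) * g j h.
Proof.
move=> uP vP WE jfl; rewrite /B_od_lo (trace_od uP vP WE h jfl) mulKf//.
apply: b_od_lo_neq0 => //.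
by have := flh_le gamma_gt0; have := fl_le gamma_gt0 gammaN; lia.
Qed.

End Boundary.

(** * Change of defining function *)

Section Conformal.
Context {R : realType} {n : nat} {gamma : R} (tau : upoint R n -> R).
Context (gamma_gt0 : 0 < gamma) (gammaN : gamma \isn't a Num.nat).
Context (tau_even : C_even tau).
Notation fl := (fl gamma).
Notation flh := (flh gamma).
Notation frac := (Defs.frac gamma).
Notation s_ev := (s_ev (n := n) gamma).
Notation s_od := (s_od (n := n) gamma).
Notation scaled := (scaled gamma).
Notation Dprod := (Dprod gamma).
Notation tildeV := (tildeV gamma).
Notation r := (rhohat tau).
Implicit Types (V W : upoint R n -> R) (p : upoint R n) (h : heis R n).

(** The weight is chosen to make [scaled r V] and [scaled rho (weighted V)] agree on rho > 0. *)
Definition weighted V p : R := expR ((n.+1%:R - gamma) * tau p) * V p.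

Lemma rhohat_gt0 p : 0 < rho p -> 0 < r p.
Proof. by move=> p0; rewrite mulr_gt0 ?expR_gt0. Qed.

Lemma rhohat_powR (a : R) p : 0 < rho p ->
  r p `^ a = expR (a * tau p) * rho p `^ a.
Proof. by move=> p0; rewrite /rhohat powRM ?expR_ge0 ?ltW// expR_powR. Qed.

Lemma scaled_weighted V p : 0 < rho p ->
  scaled r V p = scaled rho (weighted V) p.
Proof. by move=> p0; rewrite /Defs.scaled rhohat_powR// mulrCA mulrA. Qed.

Lemma trace_rhohat (a : R) (u w : upoint R n -> R) h :
  (forall p, 0 < rho p -> u p = w p) ->
  trace (fun p => r p `^ a * u p) h =
  expR (a * trace tau h) * trace (fun p => rho p `^ a * w p) h.
Proof.
move=> uw; rewrite -(trace_expR_mul tau_even).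
congr (_ h); apply: trace_eq => p p0.
by rewrite rhohat_powR// uw// mulrA.
Qed.

Lemma B_ev_lo_rhohat j V h : B_ev_lo gamma r j V h =
  expR ((- n.+1%:R + gamma - 2 * j%:R) * trace tau h)
  * B_ev_lo gamma rho j (weighted V) h.
Proof.
rewrite /B_ev_lo; case: eqP => [->|_].
  (* For index 0 both traces are first brought to the form outer power times [scaled], to which
     [trace_rhohat] applies. *)
  rewrite -(trace_scaled_cst (gamma := gamma) (weighted V)) mulr0 subr0.
  rewrite -(trace_rhohat _ _ (u := scaled r V)); last exact: scaled_weighted.
  congr (_ h); apply: trace_eq => p p0; rewrite /Defs.scaled mulrA -powRD.
    rewrite (_ : - n.+1%:R + gamma + (n.+1%:R - gamma) = 0); last by ring.
    by rewrite powRr0 mul1r.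
  by rewrite (gt_eqF (rhohat_gt0 p0)) implybT.
rewrite mulrCA; congr (_ * _); apply: trace_rhohat => p p0.
by apply: (ll_local (ll_Dprod gamma _)) => //; exact: scaled_weighted.
Qed.

Lemma B_od_lo_rhohat j V h : B_od_lo gamma r j V h =
  expR ((- n.+1%:R + gamma - 2 * j%:R - 2 * frac) * trace tau h)
  * B_od_lo gamma rho j (weighted V) h.
Proof.
rewrite /B_od_lo mulrCA; congr (_ * _); apply: trace_rhohat => p p0.
by apply: (ll_local (ll_Dprod gamma _)) => //; exact: scaled_weighted.
Qed.

(** The separate [W'] is needed because the weighted extension is only compared with [tildeV] on rho
    > 0. *)
Lemma Pi_rhohat i V W W' p : (forall q, 0 < rho q -> weighted W q = W' q) ->
  0 < rho p ->
  Pi gamma i (scaled r (fun q => V q - W q)) p =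
  Pi gamma i (scaled rho (fun q => weighted V q - W' q)) p.
Proof.
move=> WW' p0; congr (_ * _).
apply: (ll_local (ll_Dprod gamma _)) => // q q0.
by rewrite scaled_weighted// /Defs.scaled -WW'// /weighted mulrBr.
Qed.

(** Multiplication by e^(-2 s tau) on the boundary is a bijection between the possible scattering
    data for [rho] and for [r], and it fixes the default 0, so [the_map] applies whether or not the
    data are unique. *)
Lemma scatter_rhohat s (f : heis R n -> R) h :
  scatter r s f h = expR (- (2 * s) * trace tau h)
  * scatter rho s (fun h => expR (2 * (n.+1%:R - s) * trace tau h) * f h) h.
Proof.
pose phi (c : R) (k : heis R n -> R) h := expR (c * trace tau h) * k h.
have phiK c c' : c + c' = 0 -> cancel (phi c) (phi c').
  move=> cc k; apply/funext => h'.
  by rewrite /phi mulrA -expRD -mulrDl [c' + c]addrC cc mul0r expR0 mul1r.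
have ntau_even : C_even (fun p => - 1 * tau p).
  by apply: C_even_mul => //; exact: C_even_cst.
have ntauE h' : trace (fun p => - 1 * tau p) h' = - trace tau h'.
  rewrite -[RHS]mulN1r; apply: trace_cvg.
  by apply: cvgM; [exact: cvg_cst | exact: C_even_trace].
rewrite /scatter.
set P := [set g | _]; set Q := [set g | _].
rewrite (@the_map _ (cst 0) (phi (- (2 * s))) (phi (2 * s)) Q P)//.
- by apply: phiK; rewrite addNr.
- by apply: phiK; rewrite subrr.
- move=> k; split=> -[u [F [G [S Gk]]]]; exists u.
    (* From [rho] to [r] the rescaling factor is e^(-tau), since rho = e^(-tau) r; the converse
       below uses e^tau. *)
    exists (fun p => expR (2 * (n.+1%:R - s) * (- 1 * tau p)) * F p).
    exists (fun p => expR (2 * s * (- 1 * tau p)) * G p); split; last first.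
      apply/funext => h'; rewrite (trace_expR_mul ntau_even) Gk ntauE /phi.
      by rewrite mulrN mulNr.
    have -> : f = fun h =>
        expR (2 * (n.+1%:R - s) * trace (fun p => - 1 * tau p) h)
        * (expR (2 * (n.+1%:R - s) * trace tau h) * f h).
      by apply/funext => h'; rewrite ntauE mulrA -expRD mulrN addNr expR0 mul1r.
    apply: (scattering_rescale ntau_even) S => p p0.
      exact/ltW/rhohat_gt0.
    by rewrite mulrA -expRD mulN1r addNr expR0 mul1r.
  exists (fun p => expR (2 * (n.+1%:R - s) * tau p) * F p).
  exists (fun p => expR (2 * s * tau p) * G p); split; last first.
    apply/funext => h'; rewrite (trace_expR_mul tau_even) Gk /phi.
    by rewrite mulrA -expRD mulNr subrr expR0 mul1r.
  by apply: (scattering_rescale tau_even) S => p p0 //; exact: ltW.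
- by apply/funext => h'; rewrite /phi mulr0.
Qed.

Lemma Pfrac_rhohat (d : R) (f : heis R n -> R) h :
  Pfrac r d f h = expR (- (n.+1%:R + d) * trace tau h)
  * Pfrac rho d (fun h => expR ((n.+1%:R - d) * trace tau h) * f h) h.
Proof.
have -> : n.+1%:R - d = 2 * (n.+1%:R - (n.+1%:R + d) / 2) by field.
rewrite -{1}[n.+1%:R + d](@divfK _ 2)// [_ / 2 * 2]mulrC.
by rewrite /Pfrac scatter_rhohat mulrCA.
Qed.

Lemma B_ev_hi_rhohat j V W W' h : (j <= fl)%N ->
  (forall q, 0 < rho q -> weighted W q = W' q) ->
  B_ev_hi gamma r j V W h =
  expR ((- n.+1%:R + gamma - 2 * j%:R) * trace tau h)
  * B_ev_hi gamma rho j (weighted V) W' h.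
Proof.
move=> jfl WW'; rewrite /B_ev_hi [RHS]mulrDr; congr (_ + _).
  rewrite mulrCA; congr (_ * _).
  rewrite (trace_rhohat _ _
    (w := Pi gamma j (scaled rho (fun q => weighted V q - W' q)))).
    by rewrite (_ : - n.+1%:R + gamma - 2 * j%:R = - (2 * j%:R) - n.+1%:R + gamma)
      //; ring.
  by move=> p; exact: Pi_rhohat.
rewrite Pfrac_rhohat [LHS]mulrCA.
rewrite (_ : - (n.+1%:R + (2 * j%:R - gamma)) =
  - n.+1%:R + gamma - 2 * j%:R); last by ring.
congr (_ * (_ * Pfrac _ _ _ h)).
(* The weight n + 1 + gamma - 2j from the argument of P cancels the weight -(n + 1) + gamma - 2(fl -
   j) - 2 frac of the lower operator, as gamma = fl + frac. *)
apply/funext => h'; rewrite B_od_lo_rhohat mulrA -expRD -mulrDl natrB//.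
have gE := gammaE (gamma := gamma).
by rewrite [X in expR (X * _)](_ : _ = 0) ?mul0r ?expR0 ?mul1r//; lra.
Qed.

Lemma B_od_hi_rhohat j V W W' h : (j <= fl)%N ->
  (forall q, 0 < rho q -> weighted W q = W' q) ->
  B_od_hi gamma r j V W h =
  expR ((- n.+1%:R + gamma - 2 * j%:R - 2 * frac) * trace tau h)
  * B_od_hi gamma rho j (weighted V) W' h.
Proof.
move=> jfl WW'; rewrite /B_od_hi [RHS]mulrDr.
have gE := gammaE (gamma := gamma); congr (_ + _).
  rewrite mulrCA; congr (_ * _).
  rewrite (trace_rhohat _ _
    (w := Pi gamma (fl - j) (scaled rho (fun q => weighted V q - W' q)))).
    by rewrite (_ : - n.+1%:R + gamma - 2 * j%:R - 2 * frac =
      - (2 * j%:R) - 2 * frac - n.+1%:R + gamma)//; ring.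
  by move=> p; exact: Pi_rhohat.
rewrite Pfrac_rhohat [LHS]mulrCA.
rewrite (_ : - (n.+1%:R + (2 * j%:R + frac - fl%:R)) =
  - n.+1%:R + gamma - 2 * j%:R - 2 * frac); last by lra.
congr (_ * (_ * Pfrac _ _ _ h)).
(* Here n + 1 - 2j - frac + fl cancels -(n + 1) + gamma - 2(fl - j). *)
apply/funext => h'; rewrite B_ev_lo_rhohat mulrA -expRD -mulrDl natrB//.
by rewrite [X in expR (X * _)](_ : _ = 0) ?mul0r ?expR0 ?mul1r//; lra.
Qed.

(** * The extension with respect to the new defining function *)

Section Extension.
Context (V : upoint R n -> R).
Context (V_int : sufficiently_integrable gamma (weighted V)).
Notation tV := (tildeV (weighted V)).
Let c_ev j : R := (n.+1%:R - gamma + 2 * j%:R) / 2.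
Let c_od j : R := (n.+1%:R - fl%:R + frac + 2 * j%:R) / 2.
Let u_ev j p :=
  2 `^ c_ev j * poisson (s_ev j) (B_ev_lo gamma rho j (weighted V)) p.
Let u_od j p :=
  2 `^ c_od j * poisson (s_od j) (B_od_lo gamma rho j (weighted V)) p.

Lemma poissonP s (f : heis R n -> R) :
  (exists! u, is_poisson rho s f u) -> unique (is_poisson rho s f) (poisson s f).
Proof. by move=> [u Pu]; rewrite /poisson (theP _ Pu). Qed.

Lemma u_evP j : (j <= flh)%N -> is_poisson rho (s_ev j)
  (fun h => 2 `^ c_ev j * B_ev_lo gamma rho j (weighted V) h) (u_ev j).
Proof. by move=> /V_int.1/poissonP[+ _]; exact: poisson_scale. Qed.

Lemma u_odP j : (j < fl - flh)%N -> is_poisson rho (s_od j)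
  (fun h => 2 `^ c_od j * B_od_lo gamma rho j (weighted V) h) (u_od j).
Proof. by move=> /V_int.2/poissonP[+ _]; exact: poisson_scale. Qed.

Lemma scaled_tildeV p : 0 < rho p -> scaled rho tV p =
  \sum_(0 <= j < flh.+1) u_ev j p + \sum_(0 <= j < fl - flh) u_od j p.
Proof.
move=> p0.
have rE : rho p `^ (n.+1%:R - gamma) * rho p `^ (- n.+1%:R + gamma) = 1.
  rewrite -powRD ?(gt_eqF p0) ?implybT//.
  by rewrite (_ : _ - gamma + (_ + gamma) = 0) ?powRr0//; ring.
rewrite /Defs.scaled /Defs.tildeV mulrDr !mulr_sumr; congr (_ + _);
  by apply: eq_bigr => j _; rewrite mulrA mulrCA rE mulr1.
Qed.

Lemma c_ev_s j : c_ev j = n.+1%:R - s_ev j.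
Proof. by rewrite /c_ev /Defs.s_ev; field. Qed.

Lemma c_od_s j : c_od j = n.+1%:R - s_od j.
Proof. by rewrite /c_od /Defs.s_od; field. Qed.

(** The powers of 2 in [tildeV] compensate the 2^(-(n + 1 - s)) that comes from q = rho^2/2 in the
    expansion. *)
Lemma powR2K (c x : R) : 2 `^ (- c) * (2 `^ c * x) = x.
Proof. by rewrite powRN mulKf// gt_eqF// powR_gt0. Qed.

(** The candidate extension carries the inverse weight. It is cut off at rho <= 0 to meet
    [extension_out]. *)
Definition weighted_tildeV p : R :=
  if 0 < rho p then expR (- (n.+1%:R - gamma) * tau p) * tV p else 0.

Lemma weightedK_tildeV p : 0 < rho p -> weighted weighted_tildeV p = tV p.
Proof.
move=> p0; rewrite /weighted /weighted_tildeV p0 mulrA -expRD -mulrDl subrr.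
by rewrite mul0r expR0 mul1r.
Qed.

Lemma scaled_weighted_tildeV p : 0 < rho p -> scaled r weighted_tildeV p =
  \sum_(0 <= j < flh.+1) u_ev j p + \sum_(0 <= j < fl - flh) u_od j p.
Proof.
move=> p0; rewrite scaled_weighted// -scaled_tildeV//.
by rewrite /Defs.scaled weightedK_tildeV.
Qed.

Lemma is_extension_weighted_tildeV : is_extension gamma r V weighted_tildeV.
Proof.
have sumE p : 0 < rho p -> scaled rho (weighted weighted_tildeV) p =
    \sum_(0 <= j < flh.+1) u_ev j p + \sum_(0 <= j < fl - flh) u_od j p.
  by move=> p0; rewrite -scaled_weighted// scaled_weighted_tildeV.
split.
- by move=> p; rewrite /weighted_tildeV leNgt => /negbTE ->.
- move=> p p0; rewrite /L2k /Lplus.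
  by rewrite (Dprod_kill gamma_gt0 gammaN u_evP u_odP scaled_weighted_tildeV p0) !mulr0.
- move=> j jflh; apply/funext => h; rewrite !B_ev_lo_rhohat; congr (_ * _).
  rewrite (B_ev_lo_sum gamma_gt0 gammaN _ u_evP u_odP sumE jflh).
  by rewrite -c_ev_s powR2K.
- move=> j jfl; apply/funext => h; rewrite !B_od_lo_rhohat; congr (_ * _).
  rewrite (B_od_lo_sum gamma_gt0 gammaN _ u_evP u_odP sumE jfl).
  by rewrite -c_od_s powR2K.
- exists (fun j h => 2 `^ c_ev j * B_ev_lo gamma rho j (weighted V) h).
  exists (fun j h => 2 `^ c_od j * B_od_lo gamma rho j (weighted V) h).
  exists u_ev, u_od; split; [exact: u_evP | exact: u_odP |].
  exact: scaled_weighted_tildeV.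
Qed.

Lemma is_extension_unique W : is_extension gamma r V W -> W = weighted_tildeV.
Proof.
move=> [Wout _ Wev Wod [f [g [u [v [uP vP WE]]]]]].
have sumE p : 0 < rho p -> scaled rho (weighted W) p =
    \sum_(0 <= j < flh.+1) u j p + \sum_(0 <= j < fl - flh) v j p.
  by move=> p0; rewrite -scaled_weighted// WE.
have exp_inj (c x y : R) : expR c * x = expR c * y -> x = y.
  by apply: mulfI; rewrite gt_eqF ?expR_gt0.
have uE j : (j <= flh)%N -> u j = u_ev j.
  move=> jflh; have [_ pu] := poissonP (V_int.1 j jflh).
  (* By [B_ev_lo_sum] the operator of index j reads off 2^(-c) [f j] from W, and [Wev] equates it
     with that of V. So 2^(-c) [u j] solves the problem defining the Poisson solution, whose
     uniqueness comes from [V_int]. *)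
  apply/funext => p; rewrite /u_ev (pu (fun q => 2 `^ (- c_ev j) * u j q)).
    by rewrite -{1}[c_ev j]opprK powR2K.
  have <- : (fun h => 2 `^ (- c_ev j) * f j h) = B_ev_lo gamma rho j (weighted V).
    apply/funext => h; rewrite c_ev_s.
    rewrite -(B_ev_lo_sum gamma_gt0 gammaN _ uP vP sumE jflh).
    have := congr1 (fun k => k h) (Wev j jflh).
    by rewrite /= !B_ev_lo_rhohat => /exp_inj.
  exact: poisson_scale (uP j jflh).
have vE j : (j < fl - flh)%N -> v j = u_od j.
  move=> jfl; have [_ pu] := poissonP (V_int.2 j jfl).
  apply/funext => p; rewrite /u_od (pu (fun q => 2 `^ (- c_od j) * v j q)).
    by rewrite -{1}[c_od j]opprK powR2K.
  have <- : (fun h => 2 `^ (- c_od j) * g j h) = B_od_lo gamma rho j (weighted V).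
    apply/funext => h; rewrite c_od_s.
    rewrite -(B_od_lo_sum gamma_gt0 gammaN _ uP vP sumE jfl).
    have := congr1 (fun k => k h) (Wod j jfl).
    by rewrite /= !B_od_lo_rhohat => /exp_inj.
  exact: poisson_scale (vP j jfl).
apply/funext => p; have [p0|p0] := ltP 0 (rho p); last first.
  by rewrite Wout// /weighted_tildeV ltNge p0.
have : scaled r W p = scaled r weighted_tildeV p.
  rewrite scaled_weighted_tildeV// WE//; congr (_ + _).
    by apply: eq_big_nat => j /= jflh; rewrite uE.
  by apply: eq_big_nat => j /= jfl; rewrite vE.
by apply: mulfI; rewrite gt_eqF// powR_gt0// rhohat_gt0.
Qed.

Lemma extensionE : extension gamma r V = weighted_tildeV.
Proof.
apply: theP; split; first exact: is_extension_weighted_tildeV.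
by move=> W /is_extension_unique ->.
Qed.

End Extension.
End Conformal.

Unset Implicit Arguments.

Theorem theorem1p4 (R : realType) (n : nat) (gamma : R)
    (tau V : upoint R n -> R) (j : nat)
    (hn : (1 <= n)%N)
    (hgamma : 0 < gamma) (hgammaN : gamma \isn't a Num.nat)
    (htau : C_even tau)
    (hV : C2gamma gamma V)
    (hint : sufficiently_integrable gamma
              (fun p => expR ((n.+1%:R - gamma) * tau p) * V p))
    (hj : (j <= Num.truncn gamma)%N) :
  (forall h : heis R n,
     Bhat_ev gamma tau j V h =
       expR ((- n.+1%:R + gamma - 2 * j%:R) * trace tau h)
       * B_ev gamma j (fun p => expR ((n.+1%:R - gamma) * tau p) * V p) h)
  /\
  (forall h : heis R n,
     Bhat_od gamma tau j V h =
       expR ((- n.+1%:R + gamma - 2 * j%:R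
              - 2 * (gamma - (Num.truncn gamma)%:R)) * trace tau h)
       * B_od gamma j (fun p => expR ((n.+1%:R - gamma) * tau p) * V p) h).
Proof.
have extE := extensionE hgamma hgammaN htau hint.
(* The agreement on rho > 0 asked for by the lemmas on the upper operators, with [tildeV] of the
   weighted function as [W']. *)
have tildeVE := @weightedK_tildeV R n gamma tau V.
split=> h.
  rewrite /Bhat_ev /B_ev extE /B_ev_gen; case: ifP => _.
    exact: B_ev_lo_rhohat.
  exact: B_ev_hi_rhohat.
rewrite /Bhat_od /B_od extE /B_od_gen; case: ifP => _.
  exact: B_od_lo_rhohat.
exact: B_od_hi_rhohat.
Qed.
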